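(* Let $\mathcal V$ be the finite vertex set of a weighted graph with weights $\omega_{ik}$, and let $D_i\in\mathcal H_c$, $i\in\mathcal V$, be given data matrices. Define the linear mapping $\Omega\colon\mathcal Q_c\to\mathcal Q_c$ by $\Omega[\rho]_i:=\sum_{k\in\mathcal N_i}\omega_{ik}\rho_k$, $i\in\mathcal V$. Then the quantum state assignment flow equation $$\dot\rho=\mathfrak R_\rho[S(\rho)],\qquad \rho(0)=\mathbb 1_{\mathcal Q_c},$$ is equivalent to the system $$\dot\rho=\mathfrak R_\rho[\mu],\quad \rho(0)=\mathbb 1_{\mathcal Q_c},\qquad\qquad \dot\mu=\mathfrak R_\mu\big[\Omega[\mu]\big],\quad \mu(0)=S(\mathbb 1_{\mathcal Q_c}),$$ in the sense that $\rho(t)\in\mathcal Q_c$ solves the former initial value problem if and only if there is $\mu(t)\in\mathcal Q_c$ such that $(\rho(t),\mu(t))$ solves the latter.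
   Context: Fix $c\in\mathbb N$. $\mathcal H_c=\{X\in\mathbb C^{c\times c}: X^*=X\}$, $\mathcal H_{c,0}=\{X\in\mathcal H_c:\operatorname{tr}X=0\}$, $\mathcal D_c=\{\rho\in\mathcal H_c:\rho\succ0,\ \operatorname{tr}\rho=1\}$, a manifold with tangent spaces $T_\rho\mathcal D_c=\mathcal H_{c,0}$. $\langle A,B\rangle=\operatorname{tr}(AB)$. $\exp_{\mathrm m},\log_{\mathrm m}$ are the matrix exponential and logarithm. $\Pi_{c,0}[X]=X-\frac{\operatorname{tr}X}{c}I_c$. For $\rho\in\mathcal D_c$, $X\in\mathcal H_c$: $\mathbb T_\rho[X]=\frac{d}{dt}\log_{\mathrm m}(\rho+tX)|_{t=0}=\int_0^\infty(\rho+\lambda I)^{-1}X(\rho+\lambda I)^{-1}d\lambda$, with inverse $\mathbb T_\rho^{-1}[X]=\int_0^1\rho^{1-\lambda}X\rho^\lambda d\lambda$. The replicator map is $\mathfrak R_\rho[X]=\mathbb T_\rho^{-1}[X]-\langle\rho,X\rangle\rho$. $\Gamma\colon\mathcal H_{c,0}\to\mathcal D_c$, $\Gamma(X)=\exp_{\mathrm m}(X)/\operatorname{tr}\exp_{\mathrm m}(X)$, is bijective with $\Gamma^{-1}(\rho)=\Pi_{c,0}[\log_{\mathrm m}\rho]$; the same formula defines $\Gamma$ on $\mathcal H_c$. The e-exponential map is $\mathrm{Exp}^{(e)}_\rho\colon\mathcal H_{c,0}\to\mathcal D_c$, $\mathrm{Exp}^{(e)}_\rho(X)=\Gamma(\Gamma^{-1}(\rho)+\Pi_{c,0}\circ\mathbb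 T_\rho[X])$, which is invertible. Further $\exp_\rho(X)=\mathrm{Exp}^{(e)}_\rho(\mathfrak R_\rho[X])=\Gamma(\Gamma^{-1}(\rho)+X)$ for $X\in\mathcal H_{c,0}$, and the likelihood matrix is $L_\rho(D)=\exp_\rho(-\Pi_{c,0}[D])$ for $D\in\mathcal H_c$. Graph: $\mathcal G=(\mathcal V,\mathcal E,\omega)$ is a finite weighted graph, $\mathcal N_i=\{i\}\cup\{k\in\mathcal V: ik\in\mathcal E\}$, $\omega_{ik}\ge0$, $\omega_{ik}=0$ if $k\notin\mathcal N_i$, and $\sum_{k\in\mathcal N_i}\omega_{ik}=1$ for all $i\in\mathcal V$. $\mathcal Q_c=\prod_{i\in\mathcal V}\mathcal D_c$ with elements $\rho=(\rho_i)_{i\in\mathcal V}$, $\mathbb 1_{\mathcal Q_c}=(\frac1cI_c)_{i\in\mathcal V}$. The similarity map is $S(\rho)=(S_i(\rho))_{i\in\mathcal V}$, $$S_i(\rho)=\mathrm{Exp}^{(e)}_{\rho_i}\Big(\sum_{k\in\mathcal N_i}\omega_{ik}\big(\mathrm{Exp}^{(e)}_{\rho_i}\big)^{-1}\big(L_{\rho_k}(D_k)\big)\Big)\in\mathcal D_c .$$ For $\rho\in\mathcal Q_c$, $\mathfrak R_\rho$ acts factorwise: $\mathfrak R_\rho[X]_i=\mathfrak R_{\rho_i}[X_i]$. *)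

(* Defs.v *)
From HB Require Import structures.
From mathcomp Require Import all_boot all_order all_algebra.
From mathcomp Require Import sesquilinear spectral.
From mathcomp Require Import complex.
From mathcomp Require Import all_classical all_reals all_analysis.

Set Implicit Arguments.
Unset Strict Implicit.
Unset Printing Implicit Defensive.

Import Order.TTheory GRing.Theory Num.Theory.
Import numFieldNormedType.Exports.

Local Open Scope classical_set_scope.
Local Open Scope complex_scope.
Local Open Scope ring_scope.
Local Open Scope sesquilinear_scope.

Section Matrices.
Variables (R : realType) (c : nat).
Local Notation M := 'M[R[i]]_c.
Implicit Types (X rho : M) (J : set R).

(* Analysis on complex matrices is done on the real and imaginary parts of
   the entries: op is a real-valued limit, derivative or integral operator. *)
Definition entrywise (T : Type) (op : (T -> R) -> R) (F : T -> M) : M :=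
  \matrix_(i, j) (op (fun t => complex.Re (F t i j))
                  +i* op (fun t => complex.Im (F t i j))).

Definition mxlim (F : nat -> M) : M := entrywise (fun u => lim (u @ \oo)) F.

Definition mxderive (F : R -> M) (t : R) : M :=
  entrywise (fun f : R -> R => derive1 f t) F.

Definition mxintegral01 (F : R -> M) : M :=
  entrywise (fun f => \int[lebesgue_measure]_(x in `[0, 1]) f x) F.

(* Relative to J, so that the derivative is one-sided at an endpoint of J
   that belongs to J. *)
Definition has_derive_in J (f : R -> R) (t d : R) : Prop :=
  (fun s => (f s - f t) / (s - t)) @ within J t^' --> d.

Definition mx_has_derive_in J (F : R -> M) (t : R) (X : M) : Prop :=
  forall i j,
    has_derive_in J (fun s => complex.Re (F s i j)) t (complex.Re (X i j)) /\
    has_derive_in J (fun s => complex.Im (F s i j)) t (complex.Im (X i j)).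

Definition herm : set M := [set X | X^t* = X].

Definition herm0 : set M := [set X | herm X /\ \tr X = 0].

Definition posdef X : Prop :=
  forall v : 'cV[R[i]]_c, v != 0 -> 0 < (v^t* *m X *m v) 0 0.

Definition density : set M :=
  [set rho | [/\ herm rho, posdef rho & \tr rho = 1]].

Definition mxinner X Y : R[i] := \tr (X *m Y).

Definition proj0 X : M := X - (\tr X / c%:R)%:M.

Definition expm X : M :=
  mxlim (fun n => \sum_(0 <= k < n) (k`!%:R)^-1 *: X ^+ k).

(* expm is a bijection from the Hermitian matrices onto the Hermitian positive
   definite ones; logm is its inverse, with value 0 outside expm @` herm. *)
Definition logm : M -> M := 'pinv_(fun=> 0) herm expm.

Definition mxpow rho (a : R) : M := expm (a%:C *: logm rho).

Definition Tmap rho X : M := mxderive (fun t => logm (rho + t%:C *: X)) 0.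

(* The two-sided inverse of Tmap rho on herm when rho is in density. *)
Definition Tinv rho X : M :=
  mxintegral01 (fun l => mxpow rho (1 - l) *m X *m mxpow rho l).

Definition replicator rho X : M := Tinv rho X - mxinner rho X *: rho.

Definition Gam X : M := (\tr (expm X))^-1 *: expm X.

Definition Gam_inv rho : M := proj0 (logm rho).

Definition Exp_e rho X : M := Gam (Gam_inv rho + proj0 (Tmap rho X)).

Definition Exp_e_inv rho : M -> M := 'pinv_(fun=> 0) herm0 (Exp_e rho).

Definition exp_at rho X : M := Exp_e rho (replicator rho X).

Definition likelihood rho X : M := exp_at rho (- proj0 X).

End Matrices.

Arguments herm {R c}.
Arguments herm0 {R c}.
Arguments density {R c}.

Section Graph.
Variables (R : realType) (c : nat) (V : finType).
Variables (E : rel V) (w : V -> V -> R).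
Local Notation M := 'M[R[i]]_c.
Local Notation field := (V -> M).
Implicit Types (rho mu X : field) (J : set R).

(* Closed neighbourhood; E need not be symmetric or irreflexive. *)
Definition nbh (i : V) : {set V} := [set k | (k == i) || E i k].

Definition QQ : set field := [set rho | forall i, density (rho i)].

Definition barycenter : field := fun=> (c%:R^-1)%:M.

Definition similarity (D : field) rho : field := fun i =>
  Exp_e (rho i)
    (\sum_(k in nbh i)
       (w i k)%:C *: Exp_e_inv (rho i) (likelihood (rho k) (D k))).

Definition Omega rho : field := fun i => \sum_(k in nbh i) (w i k)%:C *: rho k.

Definition replicatorQ rho X : field := fun i => replicator (rho i) (X i).

(* On J, the curve rho stays in QQ and d/dt rho_i (t) = (F t)_i. *)
Definition solves_in J (rho : R -> field) (F : R -> field) : Prop :=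
  forall t, J t -> QQ (rho t) /\
    forall i, mx_has_derive_in J (fun s => rho s i) t (F t i).

Definition solves_qsaf (D : field) J (rho : R -> field) : Prop :=
  solves_in J rho (fun t => replicatorQ (rho t) (similarity D (rho t))) /\
  rho 0 = barycenter.

Definition solves_system (D : field) J (rho mu : R -> field) : Prop :=
  [/\ solves_in J rho (fun t => replicatorQ (rho t) (mu t)),
      rho 0 = barycenter,
      solves_in J mu (fun t => replicatorQ (mu t) (Omega (mu t)))
    & mu 0 = similarity D barycenter].

End Graph.

Arguments QQ {R c V}.
Arguments barycenter {R c V}.

Lemma Omega_QQ (R : realType) (c : nat) (V : finType) (E : rel V)
  (w : V -> V -> R) (rho : V -> 'M[R[i]]_c) :
  (forall i k, 0 <= w i k) -> (forall i, \sum_(k in nbh E i) w i k = 1) ->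
  QQ rho -> QQ (Omega E w rho).
Proof.
move=> w0 w1 rhoQ i.
have C k : ((w i k)%:C : R[i])^* = (w i k)%:C by rewrite conj_Creal // ger0_real // ler0c.
split.
- rewrite /herm /= /Omega raddf_sum /= raddf_sum; apply: eq_bigr => k _.
  have [h _ _] := rhoQ k.
  by rewrite -[in RHS]h linearZ /= map_mxZ /= C.
- move=> v v0; rewrite /Omega mulmx_sumr mulmx_suml summxE.
  have pos k : 0 <= (v^t* *m ((w i k)%:C *: rho k) *m v) 0 0.
    rewrite -scalemxAr -scalemxAl mxE mulr_ge0 ?ler0c //.
    by have [_ p _] := rhoQ k; exact/ltW/p.
  rewrite lt_def sumr_ge0 ?andbT; last by move=> k _; exact: pos.
  apply/negP => /eqP s0.
  have z k : k \in nbh E i -> w i k = 0.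
    move=> ki; have := psumr_eq0P (fun k _ => pos k) s0 ki.
    rewrite -scalemxAr -scalemxAl mxE => /eqP.
    have [_ /(_ v v0) p _] := rhoQ k.
    by rewrite mulf_eq0 (gt_eqF p) orbF fmorph_eq0 => /eqP.
  have := w1 i; rewrite big1 // => /esym/eqP; by rewrite oner_eq0.
- rewrite /Omega raddf_sum /=.
  under eq_bigr => k _.
    rewrite linearZ /=. have [_ _ ->] := rhoQ k. rewrite mulr1. over.
  by rewrite -rmorph_sum w1.
Qed.

(* Main.v *)
Require Import Defs.
From mathcomp Require Import all_boot all_order all_algebra.
From mathcomp Require Import sesquilinear spectral.
From mathcomp Require Import complex.
From mathcomp Require Import all_classical all_reals all_analysis.
From mathcomp Require Import ring lra.

(** The traceless logarithm Gam_inv turns the replicator equation into a plain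
    one: a curve rho of density matrices satisfies rho' = replicator rho X
    exactly when (Gam_inv rho)' = proj0 X (frechet_Gam_inv and frechet_Gam).
    In the same coordinate the similarity map is affine: similarity rho at i is
    Gam applied to the weighted sum over the neighbours k of i of
    Gam_inv (rho k) - proj0 (D k) (similarityE). The weights are passed to the
    derivative, so if rho' = replicator rho mu then the logarithm of the
    similarity at i has derivative proj0 (Omega mu i), whatever mu is
    (frechet_log_similarity).

    If rho solves the assignment flow, this statement with mu := similarity rho
    is the second equation of the system, read through Gam. Conversely, let
    (rho, mu) solve the system. Then Gam_inv (mu i) and the logarithm of the
    similarity of rho at i have the same derivative proj0 (Omega mu i) on the
    interval J, and they agree at time 0; hence they agree on J, which says
    that mu is the similarity of rho. Here a function with zero derivative on an
    interval is constant by the mean value theorem.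

    What remains is the differential calculus of expm and logm. It rests on one
    identity. Diagonalise A and B by unitary matrices U and V with real
    eigenvalues a and b. The entry (i, j) of U (f(A) - f(B)) V', with V' the
    adjoint of V, is the divided difference f[a_i, b_j] times the entry (i, j)
    of U (A - B) V'. Replacing f[a_i, b_j] by f[b_k, b_j], which costs a multiple
    of |a_i - b_k|, gives f(A) - f(B) up to a quadratic error as a linear
    function of A - B: the one that multiplies the entries in the eigenbasis of
    B by f[b_i, b_j] (spec_second_order). For exp the divided difference is the
    integral of exp((1 - x) a + x b) over [0, 1], and that linear function is
    Tinv; for log it is the reciprocal, and the linear function is Tmap. So Tinv
    and Tmap are inverse to each other, and both are derivatives. *)

Set Implicit Arguments.
Unset Strict Implicit.
Unset Printing Implicit Defensive.

Import Order.TTheory GRing.Theory Num.Theory.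
Import numFieldNormedType.Exports.

Local Open Scope ring_scope.
Local Open Scope sesquilinear_scope.

(** * Unitary diagonalisation and entrywise multipliers *)

Section UnitaryDiagonalisation.
Variables (C : numClosedFieldType) (c : nat).
Local Notation M := 'M[C]_c.
Implicit Types (U V W X Y A F G : M) (d e : 'rV[C]_c).

Lemma unitary_mulmxV U : U \is unitarymx -> U *m U^t* = 1%:M.
Proof. by move/unitarymxP. Qed.

Lemma unitary_mulVmx U : U \is unitarymx -> U^t* *m U = 1%:M.
Proof. by move/unitarymxP/mulmx1C. Qed.

Lemma unitary_mulV U V : U \is unitarymx -> V \is unitarymx ->
  U *m V^t* \is unitarymx.
Proof. by move=> uU uV; rewrite mul_unitarymx// trmxC_unitary. Qed.

Lemma unitary_adj U : U \is unitarymx -> U^t* \is unitarymx.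
Proof. by rewrite trmxC_unitary. Qed.

Lemma unitary_row_sum U i : U \is unitarymx -> \sum_j U i j * (U i j)^* = 1.
Proof.
move=> /unitarymxP/matrixP/(_ i i); rewrite !mxE eqxx => h.
by apply: etrans h; apply: eq_bigr => j _; rewrite !mxE.
Qed.

Lemma adj_mul m n p (X : 'M[C]_(m, n)) (Y : 'M[C]_(n, p)) :
  (X *m Y)^t* = Y^t* *m X^t*.
Proof. by rewrite trmx_mul map_mxM. Qed.

Lemma unsandwich U V X : U \is unitarymx -> V \is unitarymx ->
  U^t* *m (U *m X *m V^t*) *m V = X.
Proof.
move=> uU uV; rewrite !mulmxA unitary_mulVmx// mul1mx -mulmxA.
by rewrite unitary_mulVmx// mulmx1.
Qed.

Lemma sandwichK U V X : U \is unitarymx -> V \is unitarymx ->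
  U *m (U^t* *m X *m V) *m V^t* = X.
Proof.
move=> uU uV; rewrite !mulmxA unitary_mulmxV// mul1mx -mulmxA.
by rewrite unitary_mulmxV// mulmx1.
Qed.

Definition specmx U d : M := U^t* *m diag_mx d *m U.

Lemma specmx_adj U d : (specmx U d)^t* = specmx U (map_mx Num.conj d).
Proof. by rewrite /specmx !adj_mul trmxCK mulmxA tr_diag_mx map_diag_mx. Qed.

Lemma hermitian_specmx A : A^t* = A ->
  exists2 U, U \is unitarymx &
    exists2 d : 'rV[C]_c, (forall i, d 0 i \is Num.real) & A = specmx U d.
Proof.
move=> hA.
have hA' : A \is hermsymmx by apply/is_hermitianmxP; rewrite expr0 scale1r hA.
exists (spectralmx A); first exact: spectral_unitarymx.
exists (spectral_diag A).
  by move=> i; have /mxOverP := hermitian_spectral_diag_real hA'.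
rewrite /specmx -invmx_unitary ?spectral_unitarymx//.
by apply/orthomx_spectralP; exact: hermitian_normalmx.
Qed.

Lemma specmxD U d e : specmx U (d + e) = specmx U d + specmx U e.
Proof. by rewrite /specmx linearD /= mulmxDr mulmxDl. Qed.

Lemma specmxZ U k d : specmx U (k *: d) = k *: specmx U d.
Proof. by rewrite /specmx linearZ /= -scalemxAr -scalemxAl. Qed.

Lemma specmx_const U k : U \is unitarymx -> specmx U (const_mx k) = k%:M.
Proof.
move=> uU; rewrite /specmx diag_const_mx mul_mx_scalar -scalemxAl.
by rewrite unitary_mulVmx// scalemx1.
Qed.

Lemma specmxM U d e : U \is unitarymx ->
  specmx U d *m specmx U e = specmx U (\row_i (d 0 i * e 0 i)).
Proof.
move=> uU; rewrite /specmx !mulmxA -(mulmxA _ U) unitary_mulmxV// mulmx1.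
by rewrite -(mulmxA _ (diag_mx d)) mulmx_diag.
Qed.

Lemma specmxX U d k : U \is unitarymx ->
  specmx U d ^+ k = specmx U (\row_i (d 0 i ^+ k)).
Proof.
move=> uU; elim: k => [|k IH].
  rewrite expr0 (_ : \row_i _ = const_mx 1) ?specmx_const//.
  by apply/rowP => i; rewrite !mxE expr0.
rewrite exprS IH -[LHS]/(_ *m _) specmxM//; congr specmx.
by apply/rowP => i; rewrite !mxE exprS.
Qed.

Lemma tr_specmx U d : U \is unitarymx -> \tr (specmx U d) = \sum_i d 0 i.
Proof.
move=> uU; rewrite /specmx mxtrace_mulC mulmxA unitary_mulmxV// mul1mx.
exact: mxtrace_diag.
Qed.

Lemma specmx_entry U d i j :
  specmx U d i j = \sum_k ((U k i)^* * U k j) * d 0 k.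
Proof.
rewrite /specmx mul_mx_diag mxE; apply: eq_bigr => k _.
by rewrite !mxE mulrAC.
Qed.

(** Multiplying by U on the left and by the adjoint of V on the right diagonalises
    each of the two terms on its own side. *)
Lemma specmx_mixedE U V d e i j : U \is unitarymx -> V \is unitarymx ->
  (U *m (specmx U d - specmx V e) *m V^t*) i j =
  (d 0 i - e 0 j) * (U *m V^t*) i j.
Proof.
move=> uU uV; set W := U *m V^t*.
have dW : U *m specmx U d *m V^t* = diag_mx d *m W.
  by rewrite /specmx !mulmxA unitary_mulmxV// mul1mx.
have We : U *m specmx V e *m V^t* = W *m diag_mx e.
  by rewrite /specmx !mulmxA -(mulmxA _ V) unitary_mulmxV// mulmx1.
rewrite mulmxBr mulmxBl dW We mul_diag_mx mul_mx_diag !mxE.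
by rewrite mulrBl [X in _ - X]mulrC.
Qed.

Lemma specmx_diagE U d i : U \is unitarymx ->
  (U *m specmx U d *m U^t*) i i = d 0 i.
Proof.
move=> uU; rewrite /specmx !mulmxA unitary_mulmxV// mul1mx -mulmxA.
by rewrite unitary_mulmxV// mulmx1 mxE eqxx mulr1n.
Qed.

Lemma specmx_other_diagE U V e i :
  (U *m specmx V e *m U^t*) i i =
  \sum_j e 0 j * ((U *m V^t*) i j * ((U *m V^t*) i j)^*).
Proof.
have -> : U *m specmx V e *m U^t* = (U *m V^t*) *m diag_mx e *m (U *m V^t*)^t*.
  by rewrite /specmx adj_mul trmxCK !mulmxA.
rewrite mul_mx_diag mxE; apply: eq_bigr => j _.
by set W := U *m V^t*; rewrite !mxE; ring.
Qed.

Lemma specmx_sub_diagE U V d e i : U \is unitarymx ->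
  (U *m (specmx U d - specmx V e) *m U^t*) i i =
  d 0 i - \sum_j e 0 j * ((U *m V^t*) i j * ((U *m V^t*) i j)^*).
Proof.
move=> uU; rewrite mulmxBr mulmxBl mxE specmx_diagE//.
by rewrite -specmx_other_diagE [X in _ + X]mxE.
Qed.

(** The Hadamard (entrywise) product. *)
Definition schurmx F X : M := \matrix_(i, j) (F i j * X i j).

(** The multiplier of Loewner and Daleckii-Krein: entrywise multiplication by F in
    the orthonormal basis formed by the rows of V. *)
Definition loewner F V X : M := V^t* *m schurmx F (V *m X *m V^t*) *m V.

Lemma loewnerD F V X Y : loewner F V (X + Y) = loewner F V X + loewner F V Y.
Proof.
rewrite /loewner -mulmxDl -mulmxDr; congr (_ *m _ *m _).
by rewrite mulmxDr mulmxDl; apply/matrixP => i j; rewrite !mxE mulrDr.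
Qed.

Lemma loewnerZ F V k X : loewner F V (k *: X) = k *: loewner F V X.
Proof.
rewrite /loewner -scalemxAr -scalemxAl.
have -> : schurmx F (k *: (V *m X *m V^t*)) = k *: schurmx F (V *m X *m V^t*).
  by apply/matrixP => i j; rewrite !mxE mulrCA.
by rewrite -scalemxAr -scalemxAl.
Qed.

Lemma loewner_scale F V k X : loewner (k *: F) V X = k *: loewner F V X.
Proof.
rewrite /loewner.
have -> : schurmx (k *: F) (V *m X *m V^t*) = k *: schurmx F (V *m X *m V^t*).
  by apply/matrixP => i j; rewrite !mxE mulrA.
by rewrite -scalemxAr -scalemxAl.
Qed.

(** In the common eigenbasis both maps are entrywise multiplications, so entrywise
    reciprocal symbols give inverse maps. *)
Lemma loewnerK F G V X : V \is unitarymx -> (forall i j, F i j * G i j = 1) ->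
  loewner F V (loewner G V X) = X.
Proof.
move=> uV FG; rewrite /loewner sandwichK//.
have -> : schurmx F (schurmx G (V *m X *m V^t*)) = V *m X *m V^t*.
  by apply/matrixP => i j; rewrite [LHS]mxE [in LHS]mxE mulrA FG mul1r.
exact: unsandwich.
Qed.

Lemma loewner_adj F V X : F^t* = F -> X^t* = X ->
  (loewner F V X)^t* = loewner F V X.
Proof.
move=> hF hX; rewrite /loewner !adj_mul trmxCK mulmxA; congr (_ *m _ *m _).
have hY : (V *m X *m V^t*)^t* = V *m X *m V^t*.
  by rewrite !adj_mul trmxCK hX mulmxA.
move: (V *m _ *m _) hY => Y hY; apply/matrixP => i j; rewrite !mxE rmorphM /=.
by rewrite -{2}hF -{2}hY !mxE.
Qed.

Lemma loewner_scalar F V k : V \is unitarymx ->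
  loewner F V k%:M = specmx V (\row_i (k * F i i)).
Proof.
move=> uV; rewrite /loewner /specmx; congr (_ *m _ *m _).
rewrite mul_mx_scalar -scalemxAl unitary_mulmxV// scalemx1.
by apply/matrixP => i j; rewrite !mxE; case: eqP => [->|_];
  rewrite ?mulr1n ?mulr0n ?mulr0 // mulrC.
Qed.

Lemma tr_loewner F V X : V \is unitarymx ->
  \tr (loewner F V X) = \tr (specmx V (\row_i F i i) *m X).
Proof.
move=> uV; rewrite /loewner /specmx mxtrace_mulC mulmxA unitary_mulmxV// mul1mx.
rewrite -!mulmxA mxtrace_mulC -!mulmxA mulmxA mul_diag_mx.
by apply: eq_bigr => i _; rewrite !mxE.
Qed.

Lemma mixed_first_order U V d e d' e' F :
  U \is unitarymx -> V \is unitarymx ->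
  (forall i j, (d 0 i - e 0 j) * F i j = d' 0 i - e' 0 j) ->
  U *m (specmx U d' - specmx V e') *m V^t* =
  schurmx F (U *m (specmx U d - specmx V e) *m V^t*).
Proof.
move=> uU uV dF; apply/matrixP => i j.
by rewrite specmx_mixedE// -dF [RHS]mxE specmx_mixedE// mulrA [F i j * _]mulrC.
Qed.

(** With W = U V^t* unitary, K = W (W^t* K), and W^t* K is the matrix of the
    difference in the basis V, on which the multiplier G acts; so the difference
    of the two multipliers can be read off summand by summand. *)
Lemma mixed_second_order U V d e d' e' F G i j (W := U *m V^t*)
    (K := U *m (specmx U d - specmx V e) *m V^t*) :
  U \is unitarymx -> V \is unitarymx ->
  (forall i j, (d 0 i - e 0 j) * F i j = d' 0 i - e' 0 j) ->
  (U *m (specmx U d' - specmx V e' - loewner G V (specmx U d - specmx V e))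
     *m V^t*) i j =
  \sum_k (F i j - G k j) * (W i k * (W^t* *m K) k j).
Proof.
move=> uU uV dF; have uW : W \is unitarymx by exact: unitary_mulV.
rewrite mulmxBr mulmxBl (mixed_first_order uU uV dF) -/K.
have -> : U *m loewner G V (specmx U d - specmx V e) *m V^t* =
    W *m schurmx G (W^t* *m K).
  rewrite /loewner !mulmxA -[LHS]mulmxA unitary_mulmxV// mulmx1 -/W.
  congr (_ *m schurmx _ _); rewrite /W adj_mul trmxCK.
  by rewrite -(mulmxA V _ U) unitary_mulVmx// mulmx1.
rewrite mxE [X in X + _]mxE.
have -> : K i j = \sum_k W i k * (W^t* *m K) k j.
  have KE : W *m (W^t* *m K) = K by rewrite mulmxA unitary_mulmxV// mul1mx.
  by rewrite -{1}KE mxE.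
rewrite mxE [X in _ + - X]mxE mulr_sumr -sumrB; apply: eq_bigr => k _.
have -> : schurmx G (W^t* *m K) k j = G k j * (W^t* *m K) k j by rewrite mxE.
ring.
Qed.

Lemma specmx_sum U n (f : nat -> 'rV[C]_c) :
  \sum_(0 <= k < n) specmx U (f k) = specmx U (\sum_(0 <= k < n) f k).
Proof.
elim: n => [|n IH]; last by rewrite !big_nat_recr//= IH specmxD.
by rewrite !big_nil -[0 in RHS](scale0r (0 : 'rV_c)) specmxZ scale0r.
Qed.

(** Turns the integrand of Tinv into a multiplier, whose symbol alone depends on the
    variable of integration. *)
Lemma sandwich_specmx U d e X :
  specmx U d *m X *m specmx U e =
  loewner (\matrix_(i, j) (d 0 i * e 0 j)) U X.
Proof.
rewrite /loewner /specmx.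
have -> : schurmx (\matrix_(i, j) (d 0 i * e 0 j)) (U *m X *m U^t*) =
    diag_mx d *m (U *m X *m U^t*) *m diag_mx e.
  move: (U *m X *m U^t*) => S; rewrite mul_mx_diag mul_diag_mx.
  by apply/matrixP => i j; rewrite !mxE mulrAC.
by rewrite !mulmxA.
Qed.

(** Written as one sum over pairs of indices with coefficients independent of F, so
    that integration of the symbol commutes with the multiplier. *)
Lemma loewner_entry F U X i j : loewner F U X i j =
  \sum_(p : 'I_c * 'I_c)
    ((U p.1 i)^* * (U *m X *m U^t*) p.1 p.2 * U p.2 j) * F p.1 p.2.
Proof.
rewrite /loewner; move: (U *m X *m U^t*) => S.
rewrite mxE; under eq_bigr do rewrite mxE big_distrl.
rewrite exchange_big pair_bigA /=; apply: eq_bigr => -[p q] _ /=.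
by rewrite !mxE; ring.
Qed.

Lemma specmx_diag_gt0 U d i : U \is unitarymx ->
  (forall v : 'cV[C]_c, v != 0 -> 0 < (v^t* *m specmx U d *m v) 0 0) ->
  0 < d 0 i.
Proof.
move=> uU; pose v : 'cV[C]_c := U^t* *m delta_mx i 0.
have Uv : U *m v = delta_mx i 0.
  by rewrite /v mulmxA unitary_mulmxV// mul1mx.
have -> : d 0 i = (v^t* *m specmx U d *m v) 0 0.
  have -> : v^t* *m specmx U d *m v = (U *m v)^t* *m diag_mx d *m (U *m v).
    by rewrite adj_mul /specmx !mulmxA.
  rewrite Uv -colE mul_mx_diag !mxE !eqxx.
  by rewrite rmorph1 mul1r.
apply; apply/eqP => v0; move/matrixP/(_ i 0): Uv.
by rewrite v0 mulmx0 !mxE !eqxx => /esym/eqP; rewrite oner_eq0.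
Qed.

Lemma specmx_posdef U d (v : 'cV[C]_c) : U \is unitarymx ->
  (forall i, 0 < d 0 i) -> v != 0 -> 0 < (v^t* *m specmx U d *m v) 0 0.
Proof.
move=> uU d0 v0; pose u := U *m v.
have u0 : u != 0.
  apply: contraNneq v0 => u0.
  by rewrite -[v]mul1mx -(unitary_mulVmx uU) -mulmxA -/u u0 mulmx0.
have -> : (v^t* *m specmx U d *m v) 0 0 = \sum_i `|u i 0| ^+ 2 * d 0 i.
  have -> : v^t* *m specmx U d *m v = u^t* *m diag_mx d *m u.
    by rewrite /u adj_mul /specmx !mulmxA.
  rewrite mul_mx_diag mxE; apply: eq_bigr => i _.
  by rewrite normCK !mxE; ring.
have /matrix0Pn[i [j ui]] := u0; rewrite ord1 in ui.
rewrite (bigD1 i)//= ltr_wpDr ?mulr_gt0 ?exprn_gt0 ?normr_gt0//.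
by apply: sumr_ge0 => k _; rewrite mulr_ge0 ?exprn_ge0// ltW.
Qed.

(** The formula of proj0 over any numerically closed field. *)
Definition traceless X : M := X - (\tr X / c%:R)%:M.

Lemma tracelessD X Y : traceless (X + Y) = traceless X + traceless Y.
Proof.
by rewrite /traceless linearD mulrDl raddfD opprD addrACA.
Qed.

Lemma tracelessZ k X : traceless (k *: X) = k *: traceless X.
Proof.
by rewrite /traceless linearZ /= -mulrA scalerBr scale_scalar_mx.
Qed.

Lemma tracelessB X Y : traceless (X - Y) = traceless X - traceless Y.
Proof. by rewrite tracelessD -scaleN1r tracelessZ scaleN1r. Qed.

Lemma traceless_scalar k : (0 < c)%N -> traceless k%:M = 0.
Proof.
move=> c0; rewrite /traceless mxtrace_scalar -[k *+ c]mulr_natr mulfK ?subrr//.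
by rewrite pnatr_eq0 -lt0n.
Qed.

Lemma tr_traceless X : (0 < c)%N -> \tr (traceless X) = 0.
Proof.
move=> c0; rewrite /traceless linearB /= mxtrace_scalar.
rewrite -[_ / _ *+ c]mulr_natr divfK ?subrr//.
by rewrite pnatr_eq0 -lt0n.
Qed.

Lemma traceless_id X : \tr X = 0 -> traceless X = X.
Proof. by move=> X0; rewrite /traceless X0 mul0r raddf0 subr0. Qed.

Lemma tr_adj X : \tr (X^t*) = (\tr X)^*.
Proof. by rewrite /mxtrace rmorph_sum; apply: eq_bigr => i _; rewrite !mxE. Qed.

Lemma adjD X Y : (X + Y)^t* = X^t* + Y^t*.
Proof. by rewrite linearD map_mxD. Qed.

Lemma adjB X Y : (X - Y)^t* = X^t* - Y^t*.
Proof. by rewrite linearB map_mxB. Qed.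

Lemma adjZ k X : (k *: X)^t* = k^* *: X^t*.
Proof. by rewrite linearZ map_mxZ. Qed.

Lemma adj_scalar k : (k%:M : M)^t* = (k^*)%:M.
Proof. by rewrite tr_scalar_mx map_scalar_mx. Qed.

Lemma traceless_adj X : X^t* = X -> (traceless X)^t* = traceless X.
Proof.
move=> hX; rewrite /traceless adjB adj_scalar hX rmorphM fmorphV /= conjC_nat.
by rewrite -tr_adj hX.
Qed.

Lemma sub_trace_scale_adj X Y : X^t* = X -> Y^t* = Y ->
  (X - \tr X *: Y)^t* = X - \tr X *: Y.
Proof. by move=> hX hY; rewrite adjB adjZ -tr_adj hX hY. Qed.

Lemma loewnerB F V X Y : loewner F V (X - Y) = loewner F V X - loewner F V Y.
Proof. by rewrite loewnerD -[- Y]scaleN1r loewnerZ scaleN1r. Qed.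

Lemma traceless_idem X : (0 < c)%N -> traceless (traceless X) = traceless X.
Proof. by move=> c0; apply: traceless_id; exact: tr_traceless. Qed.

(** The traceless part determines a matrix up to a scalar matrix. *)
Lemma traceless_addI A X Y : (0 < c)%N ->
  traceless (A + traceless X) = traceless (A + traceless Y) ->
  X - Y = (\tr (X - Y) / c%:R)%:M.
Proof.
move=> c0; rewrite !(tracelessD A) !traceless_idem// => /addrI/eqP.
by rewrite -subr_eq0 -tracelessB /traceless subr_eq0 => /eqP.
Qed.

Lemma tr_scale1_eq0 X Y k : \tr X = 0 -> \tr Y = 1 -> X = k *: Y -> X = 0.
Proof.
move=> X0 Y1 XY; suff k0 : k = 0 by rewrite XY k0 scale0r.
by move: X0; rewrite XY mxtraceZ Y1 mulr1.
Qed.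

(** The left-hand side is the error of the linearisation of X |-> X / tr X at Y.
    Both factors on the right are linear in X - Y, so the error is quadratic. *)
Lemma normalise_remainder X Y (z := \tr X) (y := \tr Y) : z != 0 -> y != 0 ->
  z^-1 *: X - y^-1 *: Y - y^-1 *: ((X - Y) - \tr (X - Y) *: (y^-1 *: Y)) =
  (- (z - y) / (z * y)) *: ((X - Y) - \tr (X - Y) *: (y^-1 *: Y)).
Proof.
move=> z0 y0; rewrite [\tr (X - Y)]linearB /= -/z -/y; move: z y z0 y0 => {}z y z0 y0.
by apply/matrixP => i j; rewrite !mxE; field; rewrite z0 y0.
Qed.

Lemma trace_correctionB X Y Z :
  (X - Y) - \tr (X - Y) *: Z = (X - \tr X *: Z) - (Y - \tr Y *: Z).
Proof.
rewrite [\tr (X - Y)]linearB /= scalerBl; apply/matrixP => i j.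
by rewrite !mxE; ring.
Qed.

Lemma trace_correctionZ k X Z :
  k *: X - \tr (k *: X) *: Z = k *: (X - \tr X *: Z).
Proof. by rewrite mxtraceZ scalerBr scalerA. Qed.

Lemma tr_sub_trace_scale X Y : \tr Y = 1 -> \tr (X - \tr X *: Y) = 0.
Proof. by move=> Y1; rewrite linearB /= mxtraceZ Y1 mulr1 subrr. Qed.

End UnitaryDiagonalisation.

Local Open Scope classical_set_scope.
Local Open Scope complex_scope.
Local Open Scope ring_scope.
Local Open Scope sesquilinear_scope.

(** * Divided differences of the real exponential *)

Section DividedDifference.
Variable R : realType.
Implicit Types (f : R -> R) (a b m x y : R).

Definition int01 f : R := \int[lebesgue_measure]_(x in `[0, 1]) f x.

Lemma integrable01 f : continuous f ->
  (@lebesgue_measure R).-integrable `[0, 1] (EFin \o f).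
Proof.
move=> cf; apply: continuous_compact_integrable; first exact: segment_compact.
exact: continuous_subspaceT.
Qed.

Lemma int01_sum (I : Type) (s : seq I) (k : I -> R) (f : I -> R -> R) :
  (forall i, continuous (f i)) ->
  int01 (fun x => \sum_(i <- s) k i * f i x) = \sum_(i <- s) k i * int01 (f i).
Proof.
move=> cf.
have cs t : continuous (fun x => \sum_(i <- t) k i * f i x).
  elim: t => [|i t IH] x.
    rewrite (_ : (fun _ => _) = fun=> 0); first exact: cvg_cst.
    by apply/funext => y; rewrite big_nil.
  rewrite (_ : (fun _ => _) = fun y => k i * f i y + \sum_(j <- t) k j * f j y).
    2: by apply/funext => y; rewrite big_cons.
  by apply: cvgD; [apply: cvgM; [exact: cvg_cst | exact: cf] | exact: IH].
elim: s => [|i s IH].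
  rewrite big_nil /int01; under eq_Rintegral do rewrite big_nil.
  by rewrite Rintegral_cst// mul0r.
rewrite big_cons -IH /int01; under eq_Rintegral do rewrite big_cons.
rewrite RintegralD//.
- by rewrite RintegralZl//; exact: integrable01.
- by apply: integrable01 => x; apply: cvgM; [exact: cvg_cst | exact: cf].
- exact: integrable01.
Qed.

Lemma le_int01 f g : continuous f -> continuous g ->
  (forall x, 0 <= x <= 1 -> f x <= g x) -> int01 f <= int01 g.
Proof.
move=> cf cg fg; by apply: le_Rintegral => //; exact: integrable01.
Qed.

Lemma int01_cst a : int01 (fun=> a) = a.
Proof.
rewrite /int01 Rintegral_cst//.
rewrite [X in fine X](_ : _ = 1%E) ?mulr1//.
apply: (etrans (lebesgue_measure_itv `[0, 1])).
by rewrite /= lte_fin ltr01 oppr0 adde0.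
Qed.

(** Used to pass Lipschitz bounds from an integrand to its integral. *)
Lemma int01_normB f g a : continuous f -> continuous g ->
  (forall x, 0 <= x <= 1 -> `|f x - g x| <= a) -> `|int01 f - int01 g| <= a.
Proof.
move=> cf cg fg.
have cB : continuous (fun x => f x - g x).
  by move=> x; apply: cvgB; [exact: cf | exact: cg].
rewrite /int01 -RintegralB//; try exact: integrable01.
apply: le_trans (le_normr_Rintegral _ _) _ => //; first exact: integrable01.
rewrite -[leRHS]int01_cst; apply: le_int01 => //.
  by move=> x; apply: cvg_norm; exact: cB.
by move=> x; exact: cst_continuous.
Qed.

Lemma expRB_le m x y : x <= m -> y <= m -> `|expR x - expR y| <= expR m * `|x - y|.
Proof.
wlog xy : x y / y <= x.
  move=> W xm ym; case: (leP y x) => [|/ltW] h; first exact: W.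
  by rewrite distrC (distrC x); exact: W.
move=> xm ym; rewrite !ger0_norm ?subr_ge0 ?ler_expR//.
have -> : expR x - expR y = expR x * (1 - expR (y - x)).
  by rewrite mulrBr mulr1 -expRD addrCA subrr addr0.
apply: ler_pM; rewrite ?expR_ge0 ?ler_expR//.
  by rewrite subr_ge0 expR_le1 subr_le0.
have := expR_ge1Dx (y - x); lra.
Qed.

Lemma le_expRB m x y : - m <= x -> - m <= y ->
  `|x - y| <= expR m * `|expR x - expR y|.
Proof.
wlog xy : x y / y <= x.
  move=> W xm ym; case: (leP y x) => [|/ltW] h; first exact: W.
  by rewrite distrC (distrC (expR x)); exact: W.
move=> xm ym; rewrite !ger0_norm ?subr_ge0 ?ler_expR//.
have -> : expR x - expR y = expR y * (expR (x - y) - 1).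
  by rewrite mulrBr mulr1 -expRD addrCA subrr addr0.
rewrite mulrA -expRD.
have h1 : 1 <= expR (m + y) by rewrite -expR0 ler_expR; lra.
have h2 : x - y <= expR (x - y) - 1 by have := expR_ge1Dx (x - y); lra.
apply: le_trans h2 _; rewrite ler_peMl//.
by rewrite subr_ge0 -expR0 ler_expR subr_ge0.
Qed.

(** The divided difference (exp a - exp b) / (a - b), written as the integral that
    occurs in Tinv; this form has no singularity at a = b. *)
Definition expdd a b : R := int01 (fun x => expR ((1 - x) * a + x * b)).

Lemma continuous_line a b : continuous (fun x => (1 - x) * a + x * b).
Proof.
move=> x; apply: cvgD; apply: cvgM; try exact: cvg_cst; last exact: cvg_id.
by apply: cvgB; [exact: cvg_cst | exact: cvg_id].
Qed.

Lemma continuous_expdd a b : continuous (fun x => expR ((1 - x) * a + x * b)).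
Proof.
move=> x; apply: (@continuous_comp _ _ _ (fun x => (1 - x) * a + x * b) expR).
  exact: continuous_line.
exact: continuous_expR.
Qed.

(** The fundamental theorem of calculus for x |-> exp((1 - x) a + x b). *)
Lemma expddE a b : (a - b) * expdd a b = expR a - expR b.
Proof.
pose F x : R := expR ((1 - x) * a + x * b).
pose f x : R := (b - a) * F x.
have cF : continuous F := continuous_expdd (a := a) (b := b).
have cf : continuous f by move=> x; apply: cvgM; [exact: cvg_cst | exact: cF].
have dF x : is_derive x 1 F (f x).
  have dg : is_derive x 1 (fun x => (1 - x) * a + x * b) (b - a).
    apply: is_derive_eq; rewrite /GRing.scale /=; ring.
  have := @is_derive1_comp R expR (fun x => (1 - x) * a + x * b) x _ _
    (is_derive_expR _) dg.
  by rewrite /f /F mulrC.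
(* F is a primitive of (b - a) times the integrand. *)
have := @continuous_FTC2 R f F 0 1 ltr01.
move=> /(_ (continuous_subspaceT cf)) H.
have {}H : (\int[lebesgue_measure]_(x in `[0%R, 1%R]) (f x)%:E =
    (F 1%R)%:E - (F 0%R)%:E)%E.
  apply: H.
    split.
    - by move=> x _; apply: ex_derive; exact: dF.
    - by apply: cvg_at_right_filter; exact: cF.
    - by apply: cvg_at_left_filter; exact: cF.
  by move=> x _; rewrite derive1E; apply: derive_val.
have : int01 f = F 1 - F 0 by rewrite /int01 /Rintegral H.
have -> : int01 f = (b - a) * expdd a b.
  by rewrite /int01 RintegralZl//; exact: integrable01.
rewrite /F subrr subr0 !mul0r !mul1r add0r addr0 => h.
by rewrite -opprB mulNr h opprB.
Qed.

Lemma segment_ge m a b x : m <= a -> m <= b -> 0 <= x <= 1 ->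
  m <= (1 - x) * a + x * b.
Proof. by move=> ma mb /andP[x0 x1]; nra. Qed.

Lemma expdd_ge m a b : m <= a -> m <= b -> expR m <= expdd a b.
Proof.
move=> ma mb; rewrite -(int01_cst (expR m)); apply: le_int01.
- by move=> x; exact: cst_continuous.
- exact: continuous_expdd.
- by move=> x x01; rewrite ler_expR; exact: segment_ge.
Qed.

Lemma expdd_gt0 a b : 0 < expdd a b.
Proof.
apply: lt_le_trans (expdd_ge (m := Num.min a b) _ _); first exact: expR_gt0.
  by rewrite ge_min lexx.
by rewrite ge_min lexx orbT.
Qed.

Lemma expdd_diag a : expdd a a = expR a.
Proof.
rewrite -[RHS]int01_cst; apply: eq_Rintegral => x _; congr expR; ring.
Qed.

Lemma expddC a b : expdd a b = expdd b a.
Proof.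
have [->//|ab] := eqVneq a b; apply: (@mulfI _ (a - b)); first by rewrite subr_eq0.
by rewrite expddE -[in RHS](opprB b a) mulNr expddE opprB.
Qed.

Lemma expdd_shift a b k : expdd (a - k) (b - k) = expR (- k) * expdd a b.
Proof.
rewrite /expdd /int01 -RintegralZl//; last exact/integrable01/continuous_expdd.
by apply: eq_Rintegral => x _; rewrite -expRD; congr expR; ring.
Qed.

Lemma expdd_lip m a a' b : a <= m -> a' <= m -> b <= m ->
  `|expdd a b - expdd a' b| <= expR m * `|a - a'|.
Proof.
move=> am a'm bm; apply: int01_normB; try exact: continuous_expdd.
move=> x x01.
have s y : y <= m -> (1 - x) * y + x * b <= m.
  by move=> ym; move: x01 => /andP[? ?]; nra.
apply: le_trans (expRB_le (s a am) (s a' a'm)) _.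
rewrite ler_wpM2l ?expR_ge0//.
have -> : (1 - x) * a + x * b - ((1 - x) * a' + x * b) = (1 - x) * (a - a') by ring.
by move: x01 => /andP[x0 x1]; rewrite normrM ler_piMl// ger0_norm; lra.
Qed.

(** The reciprocal is the divided difference of the logarithm. The exponent 4 counts
    two reciprocals, the Lipschitz constant of expdd, and the change from the
    logarithms a and a' to the arguments of the logarithm. *)
Lemma inv_expdd_lip m a a' b :
  `|a| <= m -> `|a'| <= m -> `|b| <= m ->
  `|(expdd a b)^-1 - (expdd a' b)^-1| <= expR m ^+ 4 * `|expR a - expR a'|.
Proof.
move=> /ler_normlP[aN am] /ler_normlP[a'N a'm] /ler_normlP[bN bm].
have g x : - m <= x -> `|(expdd x b)^-1| <= expR m.
  move=> mx; rewrite ger0_norm ?invr_ge0 ?(ltW (expdd_gt0 _ _))//.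
  by rewrite -[expR m]invrK lef_pV2 ?posrE ?invr_gt0 ?expR_gt0 ?expdd_gt0//
    -expRN; apply: expdd_ge; lra.
have -> : (expdd a b)^-1 - (expdd a' b)^-1 =
    (expdd a b)^-1 * (expdd a' b)^-1 * (expdd a' b - expdd a b).
  by field; rewrite !gt_eqF ?expdd_gt0.
rewrite !normrM -[expR m ^+ 4]/(expR m * (expR m * (expR m * expR m))).
rewrite [leRHS](_ : _ = expR m * expR m * (expR m * (expR m * `|expR a - expR a'|)));
  last by ring.
apply: ler_pM; rewrite ?mulr_ge0//.
  by apply: ler_pM; rewrite ?normr_ge0// g//; lra.
rewrite distrC; apply: le_trans (expdd_lip am a'm bm) _.
by rewrite ler_wpM2l ?expR_ge0//; apply: le_expRB; lra.
Qed.

End DividedDifference.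

(** * Norm bounds for real functions of Hermitian matrices *)

Section Norm.
Variable R : realType.
Local Notation C := R[i].

(** Equivalent to the modulus, but with values in R and not in the complex numbers. *)
Definition cabs1 (z : C) : R := `|complex.Re z| + `|complex.Im z|.

Lemma cabs1_ge0 z : 0 <= cabs1 z. Proof. exact: addr_ge0. Qed.

Lemma cabs1_0 : cabs1 0 = 0. Proof. by rewrite /cabs1 /= normr0 addr0. Qed.

Lemma cabs1D z1 z2 : cabs1 (z1 + z2) <= cabs1 z1 + cabs1 z2.
Proof.
case: z1 z2 => [a b] [a' b']; rewrite /cabs1 /= addrACA.
by apply: lerD; exact: ler_normD.
Qed.

Lemma cabs1N z : cabs1 (- z) = cabs1 z.
Proof. by case: z => a b; rewrite /cabs1 /= !normrN. Qed.

Lemma cabs1M z1 z2 : cabs1 (z1 * z2) <= cabs1 z1 * cabs1 z2.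
Proof.
case: z1 z2 => [a b] [a' b']; rewrite /cabs1 /=.
apply: le_trans (lerD (ler_normB _ _) (ler_normD _ _)) _.
rewrite !normrM; nra.
Qed.

Lemma cabs1_realM (r : R) z : cabs1 (r%:C * z) = `|r| * cabs1 z.
Proof.
by case: z => a b; rewrite /cabs1 /= !mul0r subr0 addr0 !normrM mulrDr.
Qed.

Lemma cabs1_real (r : R) : cabs1 r%:C = `|r|.
Proof. by rewrite /cabs1 /= normr0 addr0. Qed.

Lemma cabs1_sum (I : Type) (s : seq I) (F : I -> C) :
  cabs1 (\sum_(i <- s) F i) <= \sum_(i <- s) cabs1 (F i).
Proof.
elim: s => [|i s IH]; first by rewrite !big_nil cabs1_0.
by rewrite !big_cons; apply: le_trans (cabs1D _ _) _; rewrite lerD2l.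
Qed.

Lemma abs_Re_le z : `|complex.Re z| <= cabs1 z.
Proof. by rewrite /cabs1 lerDl. Qed.

Lemma abs_Im_le z : `|complex.Im z| <= cabs1 z.
Proof. by rewrite /cabs1 lerDr. Qed.

(** The sum of the absolute values of the real coordinates: submultiplicative, and
    bounding each real and imaginary part. *)
Definition norm1 m n (X : 'M[C]_(m, n)) : R := \sum_i \sum_j cabs1 (X i j).

Section Rectangular.
Variables m n : nat.
Implicit Types X Y : 'M[C]_(m, n).

Lemma norm1_ge0 X : 0 <= norm1 X.
Proof. by apply: sumr_ge0 => i _; apply: sumr_ge0 => j _; exact: cabs1_ge0. Qed.

Lemma norm1D X Y : norm1 (X + Y) <= norm1 X + norm1 Y.
Proof.
rewrite /norm1 -big_split /=; apply: ler_sum => i _.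
by rewrite -big_split /=; apply: ler_sum => j _; rewrite mxE cabs1D.
Qed.

Lemma norm1N X : norm1 (- X) = norm1 X.
Proof.
by rewrite /norm1; apply: eq_bigr => i _; apply: eq_bigr => j _; rewrite mxE cabs1N.
Qed.

Lemma norm1B X Y : norm1 (X - Y) <= norm1 X + norm1 Y.
Proof. by rewrite -(norm1N Y) norm1D. Qed.

Lemma norm1_realZ (r : R) X : norm1 (r%:C *: X) = `|r| * norm1 X.
Proof.
rewrite /norm1 mulr_sumr; apply: eq_bigr => i _.
by rewrite mulr_sumr; apply: eq_bigr => j _; rewrite mxE cabs1_realM.
Qed.

Lemma cabs1_le_norm1 X i j : cabs1 (X i j) <= norm1 X.
Proof.
rewrite /norm1 (bigD1 i)//= (bigD1 j)//= -addrA lerDl addr_ge0//.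
  by apply: sumr_ge0 => *; exact: cabs1_ge0.
by apply: sumr_ge0 => *; apply: sumr_ge0 => *; exact: cabs1_ge0.
Qed.

Lemma norm1_eq0 X : norm1 X = 0 -> X = 0.
Proof.
move=> X0; apply/matrixP => i j; rewrite mxE.
have := cabs1_le_norm1 X i j; rewrite X0 => h.
have {h} : cabs1 (X i j) = 0 by apply/eqP; rewrite eq_le h cabs1_ge0.
case: (X i j) => a b /eqP; rewrite /cabs1 /= paddr_eq0// !normr_eq0.
by move=> /andP[/eqP -> /eqP ->].
Qed.

End Rectangular.

(** Submultiplicativity of the absolute value on entries is enough, because a sum
    of products is at most the product of the sums. *)
Lemma norm1M m n p (X : 'M[C]_(m, n)) (Y : 'M[C]_(n, p)) :
  norm1 (X *m Y) <= norm1 X * norm1 Y.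
Proof.
rewrite {1 2}/norm1 mulr_suml; apply: ler_sum => i _.
rewrite mulr_suml; apply: (@le_trans _ _ (\sum_k \sum_j cabs1 (X i j) * cabs1 (Y j k))).
  apply: ler_sum => k _; rewrite mxE; apply: le_trans (cabs1_sum _ _) _.
  by apply: ler_sum => j _; exact: cabs1M.
rewrite exchange_big /=; apply: ler_sum => j _.
rewrite -mulr_sumr ler_wpM2l ?cabs1_ge0// /norm1 (bigD1 j)//= lerDl.
by apply: sumr_ge0 => *; apply: sumr_ge0 => *; exact: cabs1_ge0.
Qed.

End Norm.

Section RealSpectrum.
Variables (R : realType) (c : nat).
Local Notation C := R[i].
Local Notation M := 'M[R[i]]_c.
Implicit Types (U V X A B : M) (a b : 'I_c -> R) (F G : 'I_c -> 'I_c -> R).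

(** A crude bound on the norm of a unitary matrix: each entry has modulus at most 1. *)
Definition unitary_bd : R := (2 * c * c)%:R.

Lemma unitary_bd_ge0 : 0 <= unitary_bd. Proof. exact: ler0n. Qed.

Lemma unitary_bd_exp_ge0 n : 0 <= unitary_bd ^+ n.
Proof. exact/exprn_ge0/unitary_bd_ge0. Qed.

Lemma mulC_conj (z : C) :
  z * Num.conj z = (complex.Re z ^+ 2 + complex.Im z ^+ 2)%:C.
Proof. by rewrite add_Re2_Im2 normCK. Qed.

Lemma conj_realC (r : R) : Num.conj (r%:C : C) = r%:C.
Proof. by apply: conj_Creal; rewrite complex_real. Qed.

Lemma unitary_row_sqr U i : U \is unitarymx ->
  \sum_j (complex.Re (U i j) ^+ 2 + complex.Im (U i j) ^+ 2) = 1.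
Proof.
move=> uU; apply: complexI; rewrite rmorph_sum.
apply: etrans (unitary_row_sum i uU).
by apply: eq_bigr => j _; rewrite mulC_conj.
Qed.

Lemma norm1_unitary U : U \is unitarymx -> norm1 U <= unitary_bd.
Proof.
move=> uU.
have h i j : cabs1 (U i j) <= 2.
  have : complex.Re (U i j) ^+ 2 + complex.Im (U i j) ^+ 2 <= 1.
    rewrite -(unitary_row_sqr i uU) (bigD1 j)//= lerDl.
    by apply: sumr_ge0 => k _; rewrite addr_ge0// sqr_ge0.
  rewrite -(real_normK (num_real (complex.Re _))).
  rewrite -(real_normK (num_real (complex.Im _))) /cabs1.
  set x := `|_|; set y := `|_| => xy.
  have := sqr_ge0 (x - 1); have := sqr_ge0 (y - 1); nra.
rewrite /norm1; apply: (@le_trans _ _ (\sum_(i < c) \sum_(j < c) 2)).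
  by apply: ler_sum => i _; apply: ler_sum => j _.
by rewrite !sumr_const card_ord /unitary_bd !natrM !mulr_natr.
Qed.

Lemma norm1_sandwich U V X : U \is unitarymx -> V \is unitarymx ->
  norm1 (U *m X *m V) <= unitary_bd ^+ 2 * norm1 X.
Proof.
move=> uU uV; apply: le_trans (norm1M _ _) _.
apply: le_trans (ler_pM (norm1_ge0 _) (norm1_ge0 _) (norm1M U X) (norm1_unitary uV)) _.
rewrite mulrAC expr2; apply: ler_wpM2r (norm1_ge0 _) _ _ _.
exact: ler_wpM2r unitary_bd_ge0 _ _ (norm1_unitary uU).
Qed.

Lemma norm1_mixed U V X : U \is unitarymx -> V \is unitarymx ->
  norm1 (U *m X *m V^t*) <= unitary_bd ^+ 2 * norm1 X.
Proof. by move=> uU uV; apply: norm1_sandwich uU (unitary_adj uV). Qed.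

Lemma norm1_unmixed U V X : U \is unitarymx -> V \is unitarymx ->
  norm1 X <= unitary_bd ^+ 2 * norm1 (U *m X *m V^t*).
Proof.
move=> uU uV; rewrite -[X in norm1 X <= _](unsandwich _ uU uV).
exact: norm1_sandwich (unitary_adj uU) uV.
Qed.

Definition real_row a : 'rV[C]_c := \row_i (a i)%:C.
Definition real_mx F : M := \matrix_(i, j) (F i j)%:C.
Definition spec U a : M := specmx U (real_row a).

Lemma real_rowE a i : real_row a 0 i = (a i)%:C. Proof. exact: mxE. Qed.
Lemma real_mxE F i j : real_mx F i j = (F i j)%:C. Proof. exact: mxE. Qed.

Lemma herm_spec U a : herm (spec U a).
Proof.
rewrite /herm /= /spec specmx_adj; congr specmx; apply/rowP => i.
by rewrite mxE real_rowE; exact: conj_realC.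
Qed.

(** The spectral theorem, with real eigenvalues as a real family. *)
Lemma herm_specP A : herm A -> exists2 U, U \is unitarymx & exists a, A = spec U a.
Proof.
move=> /hermitian_specmx[U uU [d dR ->]]; exists U; first exact: uU.
exists (fun i => complex.Re (d 0 i)); congr specmx; apply/rowP => i.
by rewrite real_rowE RRe_real.
Qed.

Lemma norm1_schur F (m : R) X :
  (forall i j, `|F i j| <= m) -> norm1 (schurmx (real_mx F) X) <= m * norm1 X.
Proof.
move=> Fm; rewrite /norm1 mulr_sumr; apply: ler_sum => i _.
rewrite mulr_sumr; apply: ler_sum => j _.
by rewrite mxE real_mxE cabs1_realM; exact: ler_wpM2r (cabs1_ge0 _) _ _ (Fm i j).
Qed.

Lemma norm1_loewner F (m : R) V X : V \is unitarymx -> 0 <= m ->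
  (forall i j, `|F i j| <= m) ->
  norm1 (loewner (real_mx F) V X) <= unitary_bd ^+ 4 * m * norm1 X.
Proof.
move=> uV m0 Fm; apply: le_trans (norm1_sandwich _ (unitary_adj uV) uV) _.
rewrite [leRHS](_ : _ = unitary_bd ^+ 2 * (m * (unitary_bd ^+ 2 * norm1 X)));
  last by ring.
apply: ler_wpM2l (unitary_bd_exp_ge0 _) _ _ _.
apply: le_trans (norm1_schur _ Fm) _; apply: ler_wpM2l m0 _ _ _.
exact: norm1_mixed.
Qed.

(** F i j is the divided difference, between a i and b j, of a function that maps a
    to a' and b to b'. Leaving the function out lets one statement serve both exp
    (b to exp b) and log (exp b to b). *)
Definition divided_difference F a b a' b' :=
  forall i j, (a i - b j) * F i j = a' i - b' j.

Lemma divided_differenceC F a b a' b' : divided_difference F a b a' b' -> forall i j,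
  (real_row a 0 i - real_row b 0 j) * real_mx F i j = real_row a' 0 i - real_row b' 0 j.
Proof.
by move=> aF i j; rewrite !real_rowE real_mxE -!rmorphB -aF rmorphM.
Qed.

(** In the mixed basis the difference of the images is the Hadamard product of the
    divided differences with the difference of the arguments. *)
Lemma spec_first_order U V a b a' b' F (m : R) : 0 <= m ->
  U \is unitarymx -> V \is unitarymx -> divided_difference F a b a' b' ->
  (forall i j, `|F i j| <= m) ->
  norm1 (spec U a' - spec V b') <= unitary_bd ^+ 4 * m * norm1 (spec U a - spec V b).
Proof.
move=> m0 uU uV /divided_differenceC aF Fm; apply: le_trans (norm1_unmixed _ uU uV) _.
rewrite /spec (mixed_first_order uU uV aF) -/(spec _ _) -/(spec _ _).
rewrite [leRHS](_ : _ =
  unitary_bd ^+ 2 * (m * (unitary_bd ^+ 2 * norm1 (spec U a - spec V b)))); last by ring.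
apply: ler_wpM2l (unitary_bd_exp_ge0 _) _ _ _.
apply: le_trans (norm1_schur _ Fm) _; apply: ler_wpM2l m0 _ _ _.
exact: norm1_mixed.
Qed.

(** The differences F i j - G k j are absorbed by the factor W i k, because
    (a i - b k) W i k is an entry of K. *)
Lemma norm1_second_order_sum a b F G (m h : R) (K W Y X : M) : 0 <= m ->
  (forall i k, cabs1 (K i k) = `|a i - b k| * cabs1 (W i k)) ->
  (forall i j k, `|F i j - G k j| <= m * `|a i - b k|) ->
  norm1 K <= unitary_bd ^+ 2 * h -> norm1 Y <= unitary_bd ^+ 3 * h ->
  (forall i j, X i j = \sum_k (real_mx F i j - real_mx G k j) * (W i k * Y k j)) ->
  norm1 X <= c%:R * unitary_bd ^+ 5 * m * h ^+ 2.
Proof.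
move=> m0 KW FG nK nY XE.
rewrite [leRHS](_ : _ =
    \sum_(j < c) (m * ((unitary_bd ^+ 2 * h) * (unitary_bd ^+ 3 * h)))).
  2: by rewrite sumr_const card_ord -mulr_natl; ring.
rewrite [leLHS]exchange_big; apply: ler_sum => j _.
apply: (@le_trans _ _ (\sum_i \sum_k m * (cabs1 (K i k) * norm1 Y))).
  apply: ler_sum => i _; rewrite XE; apply: le_trans (cabs1_sum _ _) _.
  apply: ler_sum => k _; rewrite !real_mxE -rmorphB cabs1_realM KW.
  rewrite [leRHS](_ : _ = (m * `|a i - b k|) * (cabs1 (W i k) * norm1 Y));
    last by ring.
  apply: ler_pM (normr_ge0 _) (cabs1_ge0 _) (FG i j k) _.
  apply: le_trans (cabs1M _ _) _.
  exact: ler_wpM2l (cabs1_ge0 _) _ _ (cabs1_le_norm1 _ _ _).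
rewrite [leLHS](_ : _ = m * (norm1 K * norm1 Y)).
  apply: ler_wpM2l m0 _ _ _.
  exact: ler_pM (norm1_ge0 _) (norm1_ge0 _) nK nY.
rewrite [norm1 K]/norm1 mulr_suml mulr_sumr; apply: eq_bigr => i _.
by rewrite mulr_suml mulr_sumr.
Qed.

(** The derivative of a matrix function by the Daleckii-Krein formula, with an
    explicit quadratic remainder. The exponent 7 collects the changes of basis:
    2 for the remainder, 2 for the mixed matrix K of A - B, and 3 for W^t* K. *)
Lemma spec_second_order U V a b a' b' F G (m : R) : 0 <= m ->
  U \is unitarymx -> V \is unitarymx -> divided_difference F a b a' b' ->
  (forall i j k, `|F i j - G k j| <= m * `|a i - b k|) ->
  norm1 (spec U a' - spec V b' - loewner (real_mx G) V (spec U a - spec V b)) <=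
  c%:R * unitary_bd ^+ 7 * m * norm1 (spec U a - spec V b) ^+ 2.
Proof.
move=> m0 uU uV /divided_differenceC aF FG.
have second i j := mixed_second_order (real_mx G) i j uU uV aF.
have KW i k : cabs1 ((U *m (spec U a - spec V b) *m V^t*) i k) =
    `|a i - b k| * cabs1 ((U *m V^t*) i k).
  rewrite (specmx_mixedE (real_row a) (real_row b) i k uU uV) !real_rowE -rmorphB.
  exact: cabs1_realM.
have nK := norm1_mixed (spec U a - spec V b) uU uV.
apply: le_trans (norm1_unmixed _ uU uV) _.
rewrite [leRHS](_ : _ = unitary_bd ^+ 2 *
  (c%:R * unitary_bd ^+ 5 * m * norm1 (spec U a - spec V b) ^+ 2)); last by ring.
apply: ler_wpM2l (unitary_bd_exp_ge0 _) _ _ _.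
apply: (norm1_second_order_sum m0 KW FG nK _ second).
apply: le_trans (norm1M _ _) _; rewrite exprS -mulrA.
apply: (ler_pM (norm1_ge0 _) (norm1_ge0 _) _ nK); apply: norm1_unitary.
exact (unitary_adj (unitary_mulV uU uV)).
Qed.

Lemma eigenvalue_le_norm1 U a i : U \is unitarymx ->
  `|a i| <= unitary_bd ^+ 2 * norm1 (spec U a).
Proof.
move=> uU; rewrite -cabs1_real -real_rowE -(specmx_diagE (real_row a) i uU).
by apply: le_trans (cabs1_le_norm1 _ _ _) _; exact: norm1_mixed.
Qed.

(** The diagonal entry of U B U^t* is an average of the eigenvalues of B, hence at
    least m, and differs from a i by an entry of U (A - B) U^t*. *)
Lemma weyl_ge U V a b m i : U \is unitarymx -> V \is unitarymx ->
  (forall j, m <= b j) -> m - unitary_bd ^+ 2 * norm1 (spec U a - spec V b) <= a i.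
Proof.
move=> uU uV mb; have := unitary_row_sqr i (unitary_mulV uU uV).
have := specmx_sub_diagE V (real_row a) (real_row b) i uU.
rewrite -/(spec U a) -/(spec V b); move: (U *m V^t*) => W e p1.
pose p j := complex.Re (W i j) ^+ 2 + complex.Im (W i j) ^+ 2.
have h1 : m <= \sum_j b j * p j.
  rewrite -[m]mulr1 -p1 mulr_sumr; apply: ler_sum => j _.
  by apply: ler_wpM2r (mb j); rewrite addr_ge0 ?sqr_ge0.
have d : (U *m (spec U a - spec V b) *m U^t*) i i = (a i - \sum_j b j * p j)%:C.
  rewrite e real_rowE rmorphB rmorph_sum; congr (_ - _).
  by apply: eq_bigr => j _; rewrite real_rowE mulC_conj rmorphM.
have : `|a i - \sum_j b j * p j| <= unitary_bd ^+ 2 * norm1 (spec U a - spec V b).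
  apply: le_trans (norm1_mixed _ uU uU); rewrite -cabs1_real -d.
  exact: cabs1_le_norm1.
rewrite ler_norml; move: (\sum_j _) h1 => S h1; lra.
Qed.

End RealSpectrum.

(** * Exponential, logarithm and Tinv in an eigenbasis *)

Section ExpLog.
Variables (R : realType) (c : nat).
Local Notation C := R[i].
Local Notation M := 'M[R[i]]_c.
Implicit Types (U V X A B rho : M) (a b : 'I_c -> R).

Lemma Re_real_mul (z : C) (r : R) : complex.Re (z * r%:C) = complex.Re z * r.
Proof. by case: z => x y; rewrite /= mulr0 subr0. Qed.

Lemma Im_real_mul (z : C) (r : R) : complex.Im (z * r%:C) = complex.Im z * r.
Proof. by case: z => x y; rewrite /= mulr0 add0r. Qed.

Lemma Re_sum (I : Type) (s : seq I) (F : I -> C) :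
  complex.Re (\sum_(i <- s) F i) = \sum_(i <- s) complex.Re (F i).
Proof.
elim: s => [|i s IH]; rewrite ?big_nil// !big_cons -IH.
by case: (F i) (\sum_(_ <- _) _) => [x y] [x' y'].
Qed.

Lemma Im_sum (I : Type) (s : seq I) (F : I -> C) :
  complex.Im (\sum_(i <- s) F i) = \sum_(i <- s) complex.Im (F i).
Proof.
elim: s => [|i s IH]; rewrite ?big_nil// !big_cons -IH.
by case: (F i) (\sum_(_ <- _) _) => [x y] [x' y'].
Qed.

Lemma spec_ReE U a i j : complex.Re (spec U a i j) =
  \sum_k complex.Re (Num.conj (U k i) * U k j) * a k.
Proof.
rewrite /spec specmx_entry Re_sum; apply: eq_bigr => k _.
by rewrite real_rowE Re_real_mul.
Qed.

Lemma spec_ImE U a i j : complex.Im (spec U a i j) =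
  \sum_k complex.Im (Num.conj (U k i) * U k j) * a k.
Proof.
rewrite /spec specmx_entry Im_sum; apply: eq_bigr => k _.
by rewrite real_rowE Im_real_mul.
Qed.

Lemma spec_exp_partial_sum U a n : U \is unitarymx ->
  \sum_(0 <= k < n) (k`!%:R)^-1 *: spec U a ^+ k =
  spec U (fun i => series (exp_coeff (a i)) n).
Proof.
move=> uU; rewrite /spec -[RHS]/(specmx _ _).
under eq_bigr do rewrite (specmxX _ _ uU) -specmxZ.
rewrite specmx_sum; congr specmx; apply/rowP => i.
rewrite summxE real_rowE /series /= rmorph_sum; apply: eq_bigr => k _.
by rewrite !mxE /= rmorphM rmorphXn fmorphV rmorph_nat mulrC.
Qed.

Lemma cvg_sumr (T I : Type) (F : set_system T) (FF : Filter F) (s : seq I)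
    (f : I -> T -> R) (l : I -> R) :
  (forall i, f i @ F --> l i) ->
  (fun x => \sum_(i <- s) f i x) @ F --> \sum_(i <- s) l i.
Proof.
by move=> fl; apply: cvg_big => [|i _]; [exact: add_continuous | exact: fl].
Qed.

Lemma cvg_sum_expR (k a : 'I_c -> R) :
  (fun n => \sum_i k i * series (exp_coeff (a i)) n) @ \oo -->
  \sum_i k i * expR (a i).
Proof.
apply: cvg_sumr => i.
by apply: cvgM; [exact: cvg_cst | exact: is_cvg_series_exp_coeff].
Qed.

(** Powers act on the eigenvalues, so the partial sums are those of the scalar
    exponential series. *)
Lemma expm_spec U a : U \is unitarymx ->
  expm (spec U a) = spec U (fun i => expR (a i)).
Proof.
move=> uU; apply/matrixP => i j; rewrite /expm /mxlim /entrywise mxE.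
apply/eqP; rewrite eq_complex; apply/andP; split; apply/eqP => /=.
- rewrite spec_ReE; apply: cvg_lim; first exact: Rhausdorff.
  under eq_fun do rewrite (spec_exp_partial_sum a _ uU) spec_ReE.
  exact: cvg_sum_expR.
- rewrite spec_ImE; apply: cvg_lim; first exact: Rhausdorff.
  under eq_fun do rewrite (spec_exp_partial_sum a _ uU) spec_ImE.
  exact: cvg_sum_expR.
Qed.

(** The same identity as for exp, read from exp a and exp b back to a and b. *)
Lemma divided_difference_log a b :
  divided_difference (fun i j => (expdd (a i) (b j))^-1) (fun i => expR (a i))
    (fun i => expR (b i)) a b.
Proof.
move=> i j; rewrite -expddE mulfK//; exact/lt0r_neq0/expdd_gt0.
Qed.

Lemma divided_difference_exp a b :
  divided_difference (fun i j => expdd (a i) (b j)) a b (fun i => expR (a i))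
    (fun i => expR (b i)).
Proof. by move=> i j; exact: expddE. Qed.

Lemma norm10 : norm1 (0 : M) = 0.
Proof. by rewrite -(scale0r (0 : M)) -[0 in LHS]/(0%:C) norm1_realZ normr0 mul0r. Qed.

(** The divided differences of the logarithm bound A - B by a multiple of
    expm A - expm B. *)
Lemma expm_inj : {in herm &, injective (@expm R c)}.
Proof.
move=> A B /[!inE] /herm_specP[U uU [a ->]] /herm_specP[V uV [b ->]].
rewrite (expm_spec a uU) (expm_spec b uV) => eAB.
(* any bound on the finitely many reciprocal divided differences will do *)
pose m := \sum_i \sum_j `|(expdd (a i) (b j))^-1|.
have := @spec_first_order _ _ U V _ _ _ _ _ m _ uU uV (divided_difference_log a b) _.
rewrite eAB subrr norm10 mulr0 => h.
apply/eqP; rewrite -subr_eq0; apply/eqP; apply: norm1_eq0.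
apply/eqP; rewrite eq_le norm1_ge0 andbT; apply: h.
- by apply: sumr_ge0 => i _; apply: sumr_ge0 => j _; exact: normr_ge0.
- move=> i j; rewrite /m (bigD1 i)//= (bigD1 j)//= -addrA lerDl.
  apply: addr_ge0.
    by apply: sumr_ge0 => *; exact: normr_ge0.
  by apply: sumr_ge0 => *; apply: sumr_ge0 => *; exact: normr_ge0.
Qed.

Lemma logm_spec U a : U \is unitarymx ->
  logm (spec U (fun i => expR (a i))) = spec U a.
Proof.
move=> uU; rewrite -(expm_spec a uU); apply: pinvKV; first exact: expm_inj.
by rewrite inE; exact: herm_spec.
Qed.

Lemma mxpow_spec U a l : U \is unitarymx ->
  mxpow (spec U (fun i => expR (a i))) l = spec U (fun i => expR (l * a i)).
Proof.
move=> uU; rewrite /mxpow (logm_spec a uU) -(expm_spec _ uU); congr expm.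
rewrite /spec -specmxZ; congr specmx; apply/rowP => i.
by rewrite mxE !real_rowE rmorphM.
Qed.

Lemma loewner_ReE (F : 'I_c -> 'I_c -> R) U X i j :
  complex.Re (loewner (real_mx F) U X i j) =
  \sum_(p : 'I_c * 'I_c) complex.Re (Num.conj (U p.1 i) *
    (U *m X *m U^t*) p.1 p.2 * U p.2 j) * F p.1 p.2.
Proof.
rewrite loewner_entry Re_sum; apply: eq_bigr => p _.
by rewrite real_mxE Re_real_mul.
Qed.

Lemma loewner_ImE (F : 'I_c -> 'I_c -> R) U X i j :
  complex.Im (loewner (real_mx F) U X i j) =
  \sum_(p : 'I_c * 'I_c) complex.Im (Num.conj (U p.1 i) *
    (U *m X *m U^t*) p.1 p.2 * U p.2 j) * F p.1 p.2.
Proof.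
rewrite loewner_entry Im_sum; apply: eq_bigr => p _.
by rewrite real_mxE Im_real_mul.
Qed.

(** The derivative of expm at spec U a. *)
Definition dexp U a X : M :=
  loewner (real_mx (fun i j => expdd (a i) (a j))) U X.

(** The derivative of logm at the exponential of spec U a. *)
Definition dlog U a X : M :=
  loewner (real_mx (fun i j => (expdd (a i) (a j))^-1)) U X.

(** The integral acts on the symbol of the multiplier only, and the integral of the
    symbol is the divided difference of exp. *)
Lemma Tinv_spec U a X : U \is unitarymx ->
  Tinv (spec U (fun i => expR (a i))) X = dexp U a X.
Proof.
move=> uU; apply/matrixP => i j; rewrite /Tinv /mxintegral01 /entrywise mxE.
have E l : mxpow (spec U (fun i => expR (a i))) (1 - l) *m X *m
    mxpow (spec U (fun i => expR (a i))) l =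
    loewner (real_mx (fun i j => expR ((1 - l) * a i + l * a j))) U X.
  rewrite !(mxpow_spec a _ uU) /spec sandwich_specmx; congr loewner.
  by apply/matrixP => p q; rewrite mxE !real_rowE real_mxE expRD rmorphM.
apply/eqP; rewrite eq_complex; apply/andP; split; apply/eqP => /=.
- rewrite loewner_ReE -int01_sum; last by move=> p; exact: continuous_expdd.
  by apply: eq_Rintegral => l _; rewrite E loewner_ReE.
- rewrite loewner_ImE -int01_sum; last by move=> p; exact: continuous_expdd.
  by apply: eq_Rintegral => l _; rewrite E loewner_ImE.
Qed.

Lemma dlogK U a X : U \is unitarymx -> dlog U a (dexp U a X) = X.
Proof.
move=> uU; apply: (loewnerK _ uU) => i j; rewrite !real_mxE -rmorphM.
by rewrite mulVf ?rmorph1//; exact/lt0r_neq0/expdd_gt0.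
Qed.

Lemma dexpK U a X : U \is unitarymx -> dexp U a (dlog U a X) = X.
Proof.
move=> uU; apply: (loewnerK _ uU) => i j; rewrite !real_mxE -rmorphM.
by rewrite mulfV ?rmorph1//; exact/lt0r_neq0/expdd_gt0.
Qed.

End ExpLog.

(** * Relative derivatives of matrix curves *)

Section RelativeDerivative.
Variables (R : realType) (c : nat).
Local Notation C := R[i].
Local Notation M := 'M[R[i]]_c.
Implicit Types (J : set R) (F G : R -> M) (X Y : M) (s t e : R).

Lemma near_within_dist J t e : 0 < e ->
  \forall s \near within J t^', `|s - t| <= e.
Proof.
move=> e0; apply: cvg_within; apply: nbhs_dnbhs.
apply/nbhs_ballP; exists e => //= s.
by rewrite /ball /= distrC => /ltW.
Qed.

Lemma near_within_neq J t : \forall s \near within J t^', s != t.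
Proof. by apply: cvg_within; near=> s; near: s; exact: nbhs_dnbhs_neq. 
Unshelve. all: by end_near. Qed.

Lemma near_within_mem J t : \forall s \near within J t^', J s.
Proof. by rewrite near_withinE; near=> s. Unshelve. all: by end_near. Qed.

Lemma has_derive_inP J (f : R -> R) t d : has_derive_in J f t d <->
  forall e, 0 < e -> \forall s \near within J t^',
    `|f s - f t - (s - t) * d| <= e * `|s - t|.
Proof.
have E s : s != t -> f s - f t - (s - t) * d =
    ((f s - f t) / (s - t) - d) * (s - t).
  by move=> st; rewrite [RHS]mulrBl divfK ?subr_eq0// [d * _]mulrC.
split=> [fd e e0|fd].
  have /cvgr_distC_le fd' := fd.
  have := near_within_neq J t; have := fd' e e0.
  apply: filterS2 => s h st; rewrite E// normrM.
  by rewrite ler_wpM2r.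
rewrite /has_derive_in; apply/cvgrPdistC_le => e e0.
have := near_within_neq J t; have := fd e e0.
apply: filterS2 => s + st; rewrite E// normrM ler_pM2r//.
by rewrite normr_gt0 subr_eq0.
Qed.

(** The relative derivative of a matrix curve in little-o form. In this form it
    composes without division by s - t. *)
Definition frechet J F t X := forall e, 0 < e -> \forall s \near within J t^',
  norm1 (F s - F t - (s - t)%:C *: X) <= e * `|s - t|.

Lemma ReB (z1 z2 : C) : complex.Re (z1 - z2) = complex.Re z1 - complex.Re z2.
Proof. by case: z1 z2 => [? ?] [? ?]. Qed.

Lemma ImB (z1 z2 : C) : complex.Im (z1 - z2) = complex.Im z1 - complex.Im z2.
Proof. by case: z1 z2 => [? ?] [? ?]. Qed.

Lemma Re_realM (r : R) (z : C) : complex.Re (r%:C * z) = r * complex.Re z.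
Proof. by case: z => ? ?; rewrite /= mul0r subr0. Qed.

Lemma Im_realM (r : R) (z : C) : complex.Im (r%:C * z) = r * complex.Im z.
Proof. by case: z => ? ?; rewrite /= mul0r addr0. Qed.

Lemma frechet_remainder F t X s i j :
  complex.Re ((F s - F t - (s - t)%:C *: X) i j) =
    complex.Re (F s i j) - complex.Re (F t i j) - (s - t) * complex.Re (X i j) /\
  complex.Im ((F s - F t - (s - t)%:C *: X) i j) =
    complex.Im (F s i j) - complex.Im (F t i j) - (s - t) * complex.Im (X i j).
Proof. by rewrite !mxE !ReB !ImB Re_realM Im_realM. Qed.

Lemma mx_has_derive_in_frechet J F t X : mx_has_derive_in J F t X <-> frechet J F t X.
Proof.
split=> [FX e e0|FX i j]; last first.
  split; apply/has_derive_inP => e e0; have := FX e e0; apply: filterS => s.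
  - have [<- _] := frechet_remainder F t X s i j; apply: le_trans.
    exact: le_trans (abs_Re_le _) (cabs1_le_norm1 _ _ _).
  - have [_ <-] := frechet_remainder F t X s i j; apply: le_trans.
    exact: le_trans (abs_Im_le _) (cabs1_le_norm1 _ _ _).
(* 2 * c * c real coordinates share the error; the successor keeps k positive. *)
pose k : R := (2 * c * c).+1%:R.
have k0 : 0 < k by rewrite ltr0n.
have h (p : 'I_c * 'I_c) : \forall s \near within J t^',
    cabs1 ((F s - F t - (s - t)%:C *: X) p.1 p.2) <= 2 * (e / k * `|s - t|).
  have [/has_derive_inP hRe /has_derive_inP hIm] := FX p.1 p.2.
  have := hIm _ (divr_gt0 e0 k0); have := hRe _ (divr_gt0 e0 k0).
  apply: filterS2 => s; have [<- <-] := frechet_remainder F t X s p.1 p.2.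
  by move=> h1 h2; rewrite /cabs1 mulr_natl mulr2n lerD.
have {}h : \forall s \near within J t^', forall p : 'I_c * 'I_c,
    cabs1 ((F s - F t - (s - t)%:C *: X) p.1 p.2) <= 2 * (e / k * `|s - t|).
  exact: filter_forall.
apply: filterS h => s hs.
rewrite /norm1; apply: (@le_trans _ _
    (\sum_(i < c) \sum_(j < c) 2 * (e / k * `|s - t|))).
  by apply: ler_sum => i _; apply: ler_sum => j _; exact: (hs (i, j)).
rewrite !sumr_const card_ord -!mulrnA -mulr_natl.
rewrite [leLHS](_ : _ = (2 * c * c)%:R / k * (e * `|s - t|)).
  rewrite ler_piMl ?mulr_ge0 ?(ltW e0)// ler_pdivrMr// mul1r ler_nat.
  exact: leqnSn.
by rewrite !natrM; field; exact: lt0r_neq0.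
Qed.

Lemma frechet_bound J F t X : frechet J F t X ->
  \forall s \near within J t^', norm1 (F s - F t) <= (norm1 X + 1) * `|s - t|.
Proof.
move=> /(_ 1 ltr01); apply: filterS => s; rewrite mul1r => h.
have := norm1D (F s - F t - (s - t)%:C *: X) ((s - t)%:C *: X).
rewrite subrK norm1_realZ; move: h.
by move: (norm1 _) (norm1 _) (norm1 X) => x y z; move: `|s - t| => d; lra.
Qed.

(** Fréchet differentiability of f at X along P, with a quadratic remainder. P is
    the domain in which f behaves well, such as the Hermitian matrices. *)
Definition second_order_at (P : M -> Prop) (f L : M -> M) X :=
  exists2 K : R, 0 <= K & exists2 e, 0 < e &
  forall Y, P Y -> norm1 (Y - X) <= e ->
    norm1 (f Y - f X - L (Y - X)) <= K * norm1 (Y - X) ^+ 2.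

Definition linear_bounded (L : M -> M) :=
  [/\ forall X Y, L (X - Y) = L X - L Y,
      forall (r : R) X, L (r%:C *: X) = r%:C *: L X &
      exists2 K : R, 0 <= K & forall X, norm1 (L X) <= K * norm1 X].

(** The chain rule. F moves at most linearly in s - t, so the quadratic remainder of f
    is of order (s - t) ^ 2. *)
Lemma frechet_comp (P : M -> Prop) (f L : M -> M) J F t X :
  linear_bounded L -> second_order_at P f L (F t) ->
  (\forall s \near within J t^', P (F s)) ->
  frechet J F t X -> frechet J (f \o F) t (L X).
Proof.
move=> [LB LZ [KL KL0 HL]] [K K0 [d d0 Hf]] PF FX e e0 /=.
set q := norm1 X + 1.
have q0 : 0 < q by rewrite ltr_wpDl ?norm1_ge0.
have e1 : 0 < e / (2 * (KL + 1)) by rewrite divr_gt0// mulr_gt0// ltr_wpDl.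
have e2 : 0 < d / q by exact: divr_gt0.
have e3 : 0 < e / (2 * (K * q ^+ 2 + 1)).
  by rewrite divr_gt0// mulr_gt0// ltr_wpDl// mulr_ge0 ?exprn_ge0 ?(ltW q0).
near=> s.
have h1 : norm1 (F s - F t) <= q * `|s - t| by near: s; exact: frechet_bound.
have h2 : norm1 (F s - F t - (s - t)%:C *: X) <= e / (2 * (KL + 1)) * `|s - t|.
  by near: s; exact: FX.
have h3 : `|s - t| <= d / q by near: s; exact: near_within_dist.
have h4 : `|s - t| <= e / (2 * (K * q ^+ 2 + 1)).
  by near: s; exact: near_within_dist.
have h5 : norm1 (F s - F t) <= d.
  by apply: le_trans h1 _; rewrite mulrC -ler_pdivlMr.
have h6 : P (F s) by near: s.
have h7 := Hf _ h6 h5.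
have h8 := HL (F s - F t - (s - t)%:C *: X).
have -> : f (F s) - f (F t) - (s - t)%:C *: L X =
    (f (F s) - f (F t) - L (F s - F t)) + L (F s - F t - (s - t)%:C *: X).
  by rewrite (LB (F s - F t)) LZ addrA subrK.
apply: le_trans (norm1D _ _) _.
(* The quadratic remainder and the remainder of F pushed through L take half
   of the error each. *)
have a0 : norm1 (F s - F t) ^+ 2 <= (q * `|s - t|) ^+ 2.
  by rewrite ler_pXn2r ?nnegrE ?norm1_ge0 ?mulr_ge0 ?(ltW q0).
have a1 : K * norm1 (F s - F t) ^+ 2 <= e / 2 * `|s - t|.
  apply: le_trans (ler_wpM2l K0 a0) _.
  rewrite exprMn mulrA [X in _ * X]expr2 mulrA ler_wpM2r//.
  have B0 : 0 <= K * q ^+ 2 by rewrite mulr_ge0 ?exprn_ge0 ?(ltW q0).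
  rewrite (_ : e / 2 = (K * q ^+ 2 + 1) * (e / (2 * (K * q ^+ 2 + 1)))).
    by apply: ler_pM => //; rewrite lerDl.
  by field; rewrite gt_eqF// ltr_wpDl.
have a2 : KL * norm1 (F s - F t - (s - t)%:C *: X) <= e / 2 * `|s - t|.
  apply: le_trans (ler_wpM2l KL0 h2) _; rewrite mulrA ler_wpM2r//.
  rewrite (_ : e / 2 = (KL + 1) * (e / (2 * (KL + 1)))).
    by rewrite ler_wpM2r ?(ltW e1)// lerDl.
  by field; rewrite gt_eqF// ltr_wpDl.
rewrite [leRHS](_ : _ = e / 2 * `|s - t| + e / 2 * `|s - t|); last by field.
by apply: lerD; [exact: le_trans h7 a1 | exact: le_trans h8 a2].
Unshelve. all: by end_near. Qed.

Lemma frechet_linear (L : M -> M) J F t X : linear_bounded L ->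
  frechet J F t X -> frechet J (L \o F) t (L X).
Proof.
move=> Ll; apply: (@frechet_comp (fun=> True)) => //.
  exists 0 => //; exists 1 => // Y _ _.
  by case: Ll => [-> _ _]; rewrite subrr norm10 mul0r.
exact: nearW.
Qed.

Lemma frechet_cst J X t : frechet J (fun=> X) t 0.
Proof.
move=> e e0; apply: nearW => s; rewrite subrr sub0r scaler0 norm1N norm10.
by rewrite mulr_ge0// ltW.
Qed.

Lemma frechetD J F G t X Y : frechet J F t X -> frechet J G t Y ->
  frechet J (fun s => F s + G s) t (X + Y).
Proof.
move=> FX GY e e0; have e2 : 0 < e / 2 by rewrite divr_gt0.
have := GY _ e2; have := FX _ e2; apply: filterS2 => s h1 h2.
rewrite [X in norm1 X](_ : _ = (F s - F t - (s - t)%:C *: X) +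
  (G s - G t - (s - t)%:C *: Y)).
  apply: le_trans (norm1D _ _) _; apply: le_trans (lerD h1 h2) _.
  by rewrite -mulrDl -splitr.
by apply/matrixP => i j; rewrite !mxE; ring.
Qed.

Lemma frechetZ J F t X (r : R) : frechet J F t X ->
  frechet J (fun s => r%:C *: F s) t (r%:C *: X).
Proof.
apply: (@frechet_linear (fun Y => r%:C *: Y)); split.
- by move=> Y Z; rewrite scalerBr.
- by move=> k Y; rewrite !scalerA mulrC.
- by exists `|r| => // Y; rewrite norm1_realZ.
Qed.

Lemma frechet_sum (I : Type) (l : seq I) (p : pred I) J (F : I -> R -> M) t (X : I -> M) :
  (forall i, frechet J (F i) t (X i)) ->
  frechet J (fun s => \sum_(i <- l | p i) F i s) t (\sum_(i <- l | p i) X i).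
Proof.
move=> FX; elim: l => [|i l IH].
  rewrite big_nil (_ : (fun _ => _) = fun=> 0); first exact: frechet_cst.
  by apply/funext => s; rewrite big_nil.
rewrite big_cons (_ : (fun s => \sum_(_ <- _ | _) _) =
  fun s => if p i then F i s + \sum_(j <- l | p j) F j s
           else \sum_(j <- l | p j) F j s).
  by case: (p i); [exact: frechetD | exact: IH].
by apply/funext => s; rewrite big_cons.
Qed.

Lemma frechet_eq J F G t X : (forall s, J s -> F s = G s) -> J t ->
  frechet J F t X -> frechet J G t X.
Proof.
move=> FG Jt FX e e0; have := near_within_mem J t; have := FX _ e0.
by apply: filterS2 => s + Js; rewrite (FG s)// (FG t).
Qed.

(** At s = t both sides vanish, so the estimate holds on the whole ball. *)
Lemma has_derive_in_ball J (f : R -> R) t d e : has_derive_in J f t d -> 0 < e ->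
  exists2 r, 0 < r & forall s, `|s - t| < r -> J s ->
    `|f s - f t - (s - t) * d| <= e * `|s - t|.
Proof.
move=> /has_derive_inP fd e0; have := fd e e0.
rewrite near_withinE => /nbhs_ballP[r /= r0 H]; exists r => // s sr Js.
have [->|st] := eqVneq s t; first by rewrite !subrr mul0r subr0 normr0 mulr0.
by apply: (H s) => //; rewrite /ball /= distrC.
Qed.

(** The mean value theorem. At an end point of J only the one-sided derivative is
    given, which still yields continuity on the closed segment. *)
Lemma const_of_derive0 J (f : R -> R) : is_interval J ->
  (forall t, J t -> has_derive_in J f t 0) ->
  forall s t, J s -> J t -> f s = f t.
Proof.
move=> Ji fd; suff H s t : J s -> J t -> s < t -> f s = f t.
  move=> s t Js Jt; case: (ltgtP s t) => [st|ts|->//]; first exact: H.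
  by apply/esym; exact: H.
move=> Js Jt st.
have sub x : s <= x <= t -> J x by move=> xst; exact: (Ji s t).
have ball x e : J x -> 0 < e -> exists2 r, 0 < r &
    forall y, `|y - x| < r -> J y -> `|f y - f x| <= e * `|y - x|.
  move=> Jx e0; have [r r0 H] := has_derive_in_ball (fd x Jx) e0.
  by exists r => // y yr Jy; have := H y yr Jy; rewrite mulr0 subr0.
have cont : {within `[s, t], continuous f}.
  apply/subspace_continuousP => x /= xst.
  have {}xst : s <= x <= t by move: xst; rewrite in_itv.
  apply/cvgrPdistC_le => e e0; rewrite near_withinE.
  have [r r0 H] := ball x 1 (sub x xst) ltr01.
  apply/nbhs_ballP; exists (Num.min r e); first by rewrite /= lt_min r0 e0.
  move=> y xy yst; have : `|y - x| < Num.min r e by rewrite distrC; exact: xy.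
  rewrite lt_min => /andP[yr ye].
  have {}yst : s <= y <= t by move: yst; rewrite /= in_itv.
  by apply: le_trans (H y yr (sub y yst)) _; rewrite mul1r ltW.
have der x : x \in `]s, t[ -> is_derive x 1 f 0.
  rewrite in_itv /= => /andP[sx xt].
  have Jx : J x by apply: sub; rewrite !ltW.
  have cv : (fun h => h^-1 *: (f (h *: (1 : R) + x) - f x)) @ 0^' --> (0 : R).
    apply/cvgrPdistC_le => e e0; have [r r0 H] := ball x e Jx e0.
    apply/nbhs_ballP; exists (Num.min r (Num.min (x - s) (t - x))).
      by rewrite /= !lt_min r0 !subr_gt0 sx xt.
    move=> h h1 h0.
    have : `|h| < Num.min r (Num.min (x - s) (t - x)).
      by rewrite -[h]subr0 distrC; exact: h1.
    rewrite !lt_min => /andP[hr /andP[hs ht]].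
    rewrite subr0 [h *: _]mulr1 normrM normfV ler_pdivrMl ?normr_gt0//.
    have := H (h + x); rewrite addrK [`|h| * _]mulrC; apply => //.
    apply: sub; move: hs ht; rewrite !ltr_norml => /andP[? ?] /andP[? ?].
    by apply/andP; split; lra.
  by apply: DeriveDef; [apply/cvg_ex; exists 0 | apply: cvg_lim].
have [y _ yE] := MVT st der cont.
by apply/esym/eqP; rewrite -subr_eq0 yE mul0r.
Qed.

Lemma const_of_frechet0 J F : is_interval J -> (forall t, J t -> frechet J F t 0) ->
  forall s t, J s -> J t -> F s = F t.
Proof.
move=> Ji F0 s t Js Jt; apply/matrixP => i j.
have H u : J u -> mx_has_derive_in J F u 0.
  by move=> Ju; apply/mx_has_derive_in_frechet/F0.
apply/eqP; rewrite eq_complex; apply/andP; split; apply/eqP.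
- apply: (const_of_derive0 (f := fun s => complex.Re (F s i j)) Ji) => // u Ju.
  by have [] := H u Ju i j; rewrite mxE.
- apply: (const_of_derive0 (f := fun s => complex.Im (F s i j)) Ji) => // u Ju.
  by have [] := H u Ju i j; rewrite mxE.
Qed.

Lemma has_derive_in_derive1 (f : R -> R) d : has_derive_in setT f 0 d ->
  derive1 f 0 = d.
Proof.
move=> fd; apply: cvg_lim; first exact: Rhausdorff.
apply/cvgrPdistC_le => e e0; have [r r0 H] := has_derive_in_ball fd e0.
apply/nbhs_ballP; exists r => // h; rewrite /ball /= sub0r normrN => hr h0.
have := H h; rewrite subr0 => /(_ hr Logic.I) {}H.
rewrite addr0 /GRing.scale /=.
have -> : h^-1 * (f h - f 0) - d = h^-1 * (f h - f 0 - h * d).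
  by rewrite [RHS]mulrBr mulKf.
by rewrite normrM normfV ler_pdivrMl ?normr_gt0// [`|h| * _]mulrC.
Qed.

Lemma frechet_mxderive F X : frechet setT F 0 X -> mxderive F 0 = X.
Proof.
move=> /mx_has_derive_in_frechet FX; apply/matrixP => i j; rewrite mxE.
have [hRe hIm] := FX i j.
rewrite (has_derive_in_derive1 hRe) (has_derive_in_derive1 hIm).
by case: (X i j).
Qed.

End RelativeDerivative.

(** * Derivatives of the matrix exponential and logarithm *)

Section ExpLogDerivative.
Variables (R : realType) (c : nat).
Local Notation C := R[i].
Local Notation M := 'M[R[i]]_c.
Implicit Types (J : set R) (F : R -> M) (U V X Y Z A B rho : M) (a b : 'I_c -> R).

Definition spec_exp U a : M := spec U (fun i => expR (a i)).

Lemma linear_bounded_loewner (F : 'I_c -> 'I_c -> R) V (m : R) :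
  V \is unitarymx -> 0 <= m -> (forall i j, `|F i j| <= m) ->
  linear_bounded (loewner (real_mx F) V).
Proof.
move=> uV m0 Fm; split.
- exact: loewnerB.
- by move=> r X; exact: loewnerZ.
- exists (unitary_bd R c ^+ 4 * m).
    by apply: mulr_ge0 m0; exact: unitary_bd_exp_ge0.
  by move=> X; exact: norm1_loewner.
Qed.

Lemma family_bound a : exists2 m, 0 <= m & forall i, `|a i| <= m.
Proof.
exists (\sum_i `|a i|); first by apply: sumr_ge0.
by move=> i; rewrite (bigD1 i)//= lerDl; apply: sumr_ge0.
Qed.

Lemma linear_bounded_dexp V b : V \is unitarymx -> linear_bounded (dexp V b).
Proof.
move=> uV; have [m m0 bm] := family_bound b.
apply: (@linear_bounded_loewner _ _ (expR m + expR m * (m + m)) uV).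
  by rewrite addr_ge0 ?mulr_ge0 ?addr_ge0 ?expR_ge0.
move=> i j; have := expdd_lip (m := m) (a := b i) (a' := b j) (b := b j).
move=> /(_ (ler_normlW (bm i)) (ler_normlW (bm j)) (ler_normlW (bm j))) h.
have hj : expR (b j) <= expR m by rewrite ler_expR ler_normlW.
rewrite expdd_diag in h.
have h2 : `|b i - b j| <= m + m by apply: le_trans (ler_normB _ _) (lerD _ _).
have h3 := ler_wpM2l (expR_ge0 m) h2.
rewrite -[X in `|X|](subrK (expR (b j))); apply: le_trans (ler_normD _ _) _.
rewrite [leRHS]addrC [`|expR _|]ger0_norm ?expR_ge0//.
exact: lerD (le_trans h h3) hj.
Qed.

Lemma linear_bounded_dlog V b : V \is unitarymx -> linear_bounded (dlog V b).
Proof.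
move=> uV; have [m m0 bm] := family_bound b.
apply: (@linear_bounded_loewner _ _ (expR m) uV); first exact: expR_ge0.
move=> i j; rewrite ger0_norm ?invr_ge0 ?(ltW (expdd_gt0 _ _))//.
rewrite -[expR m]invrK lef_pV2 ?posrE ?invr_gt0 ?expR_gt0 ?expdd_gt0// -expRN.
by apply: expdd_ge; rewrite lerNl; [have := bm i|have := bm j];
  rewrite ler_norml lerNl => /andP[].
Qed.

(** Matrices near spec V b have bounded eigenvalues, and on bounded sets the divided
    difference of exp is Lipschitz. *)
Lemma expm_second_order V b : V \is unitarymx ->
  second_order_at herm (@expm R c) (dexp V b) (spec V b).
Proof.
move=> uV.
set m := unitary_bd R c ^+ 2 * (norm1 (spec V b) + 1).
exists (c%:R * unitary_bd R c ^+ 7 * expR m).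
  by apply: mulr_ge0 (expR_ge0 _); apply: mulr_ge0 (ler0n _ _) (unitary_bd_exp_ge0 _ _ _).
exists 1; first exact: ltr01.
move=> A /herm_specP[U uU [a ->]] near.
rewrite (expm_spec a uU) (expm_spec b uV).
have am i : a i <= m.
  apply: le_trans (ler_norm _) _; apply: le_trans (eigenvalue_le_norm1 a i uU) _.
  apply: ler_wpM2l; first exact: unitary_bd_exp_ge0.
  have := norm1D (spec U a - spec V b) (spec V b); rewrite subrK => h.
  by apply: le_trans h _; rewrite addrC lerD2l.
have bm i : b i <= m.
  apply: le_trans (ler_norm _) _; apply: le_trans (eigenvalue_le_norm1 b i uV) _.
  by apply: ler_wpM2l; [exact: unitary_bd_exp_ge0 | rewrite lerDl].
apply: (spec_second_order (expR_ge0 m) uU uV (divided_difference_exp a b)).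
by move=> i j k; apply: expdd_lip.
Qed.

(** Hermitian matrices near a positive definite one are positive definite, with
    eigenvalues bounded and bounded away from 0; there the divided difference of the
    logarithm is Lipschitz. *)
Lemma logm_second_order V b : V \is unitarymx ->
  second_order_at herm (@logm R c) (dlog V b) (spec_exp V b).
Proof.
move=> uV; have [l l0 bl] := family_bound b.
have k0 : 0 < unitary_bd R c ^+ 2 + 1 by rewrite ltr_wpDl ?unitary_bd_exp_ge0.
pose lo := expR (- l).
have lo0 : 0 < lo by exact: expR_gt0.
(* At this distance the eigenvalues of the perturbed matrix stay above lo / 2,
   by Weyl's inequality, so that their logarithms stay bounded. *)
pose e := lo / 2 / (unitary_bd R c ^+ 2 + 1).
have e0 : 0 < e by rewrite !divr_gt0.
pose top := unitary_bd R c ^+ 2 * (norm1 (spec_exp V b) + e) + 1.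
have top0 : 0 < top.
  apply: ltr_wpDl => //; apply: mulr_ge0 (unitary_bd_exp_ge0 _ _ _) _.
  by rewrite addr_ge0 ?norm1_ge0 ?ltW.
pose m := l + `|ln (lo / 2)| + `|ln top|.
exists (c%:R * unitary_bd R c ^+ 7 * expR m ^+ 4).
  apply: mulr_ge0 (exprn_ge0 _ (expR_ge0 _)).
  exact: mulr_ge0 (ler0n _ _) (unitary_bd_exp_ge0 _ _ _).
exists e; first exact: e0.
move=> A /herm_specP[U uU [x ->]] near.
have xlo i : lo / 2 <= x i.
  have := @weyl_ge _ _ _ _ x _ lo i uU uV (fun j => _).
  move=> /(_ (fun i => expR (b i))).
  have hb j : lo <= expR (b j).
    by rewrite ler_expR; have := bl j; rewrite ler_norml => /andP[].
  move=> /(_ hb); apply: le_trans.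
  have : unitary_bd R c ^+ 2 * norm1 (spec U x - spec_exp V b) <= lo / 2.
    apply: le_trans (_ : (unitary_bd R c ^+ 2 + 1) * e <= _).
      by apply: ler_pM near; rewrite ?unitary_bd_exp_ge0 ?norm1_ge0 ?lerDl.
    by rewrite /e mulrCA mulfV ?mulr1// gt_eqF.
  rewrite -/(spec_exp V b); move: (_ * norm1 _) => y; lra.
have xtop i : x i <= top.
  apply: le_trans (ler_norm _) _; apply: le_trans (eigenvalue_le_norm1 x i uU) _.
  rewrite /top ler_wpDr//; apply: ler_wpM2l; first exact: unitary_bd_exp_ge0.
  have := norm1D (spec U x - spec_exp V b) (spec_exp V b); rewrite subrK => h.
  by apply: le_trans h _; rewrite addrC lerD2l.
pose a i := ln (x i).
have x0 i : 0 < x i by apply: lt_le_trans (xlo i); rewrite divr_gt0.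
have xa : x = (fun i => expR (a i)) by apply/funext => i; rewrite lnK// posrE.
have am i : `|a i| <= m.
  have h1 : ln (lo / 2) <= a i by rewrite ler_ln ?posrE ?divr_gt0.
  have h2 : a i <= ln top by rewrite ler_ln ?posrE.
  have := ler_norm (ln top); have := lerNnormlW (lexx `|ln (lo / 2)|).
  have := normr_ge0 (ln top); have := normr_ge0 (ln (lo / 2)).
  by rewrite ler_norml /m => *; apply/andP; split; lra.
have bm i : `|b i| <= m by rewrite /m -addrA ler_wpDr ?addr_ge0.
rewrite xa (logm_spec a uU) (logm_spec b uV).
apply: (spec_second_order _ uU uV (divided_difference_log a b)).
  exact: exprn_ge0 _ (expR_ge0 _).
by move=> i j k; apply: inv_expdd_lip.
Qed.

(** The derivative of logm along a line, by the chain rule. *)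
Lemma Tmap_spec U a X : U \is unitarymx -> herm X ->
  Tmap (spec_exp U a) X = dlog U a X.
Proof.
move=> uU hX; apply: frechet_mxderive.
pose F (t : R) : M := spec_exp U a + t%:C *: X.
have F0 : F 0 = spec_exp U a by rewrite /F scale0r addr0.
apply: (@frechet_comp _ _ herm _ _ _ F).
- exact: linear_bounded_dlog.
- by rewrite F0; exact: logm_second_order.
- apply: nearW => s; rewrite /herm /=.
  rewrite [in LHS]linearD map_mxD (herm_spec U) linearZ map_mxZ hX.
  by congr (_ + _ *: _); exact: conj_realC.
- move=> e e0; apply: nearW => s.
  rewrite F0 /F subr0 (addrC (spec_exp U a)) addrK subrr norm10.
  by apply: mulr_ge0 (normr_ge0 _); exact: ltW.
Qed.

End ExpLogDerivative.

(** * Density matrices, Gam and the replicator map *)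

Section Density.
Variables (R : realType) (c : nat).
Local Notation C := R[i].
Local Notation M := 'M[R[i]]_c.
Implicit Types (J : set R) (F : R -> M) (U V X Y Z A B rho : M) (a b : 'I_c -> R).

Lemma tr_spec U a : U \is unitarymx -> \tr (spec U a) = (\sum_i a i)%:C.
Proof.
move=> uU; rewrite /spec (tr_specmx _ uU) rmorph_sum.
by apply: eq_bigr => i _; exact: real_rowE.
Qed.

Lemma tr_spec_exp U a : U \is unitarymx -> \tr (spec_exp U a) = (\sum_i expR (a i))%:C.
Proof. exact: tr_spec. Qed.

Lemma density_gt0 rho : density rho -> (0 < c)%N.
Proof.
move=> [_ _]; case: (posnP c) => // c0; rewrite /mxtrace big1 => [/esym/eqP|i].
  by rewrite oner_eq0.
by have := ltn_ord i; rewrite [X in (_ < X)%N]c0.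
Qed.

(** A positive definite matrix has positive eigenvalues, so it is the exponential of
    a Hermitian matrix with the same eigenvectors. *)
Lemma density_spec_expP rho : density rho -> exists2 U, U \is unitarymx &
  exists2 a, rho = spec_exp U a & \sum_i expR (a i) = 1.
Proof.
move=> [/herm_specP[U uU [x ->]] pos tr1]; exists U; first exact: uU.
have x0 i : 0 < x i.
  have := specmx_diag_gt0 (d := real_row x) i uU pos.
  by rewrite real_rowE ltcR.
have xa : x = (fun i => expR (ln (x i))).
  by apply/funext => i; rewrite lnK// posrE.
exists (fun i => ln (x i)); first by rewrite /spec_exp -xa.
move: tr1; rewrite (tr_spec _ uU) {1}xa => h.
exact: complexI h.
Qed.

Lemma spec_exp_density U a : U \is unitarymx -> \sum_i expR (a i) = 1 ->
  density (spec_exp U a).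
Proof.
move=> uU a1; split.
- exact: herm_spec.
- move=> v v0; apply: (specmx_posdef uU _ v0) => i.
  by rewrite real_rowE ltcR expR_gt0.
- by rewrite (tr_spec _ uU) a1.
Qed.

Lemma sum_expR_gt0 a : (0 < c)%N -> 0 < \sum_i expR (a i).
Proof.
move=> c0; rewrite (bigD1 (Ordinal c0))//=; apply: ltr_wpDr; last exact: expR_gt0.
by apply: sumr_ge0 => i _; exact: expR_ge0.
Qed.

(** The logarithm of the trace of the exponential; subtracting it from the exponents
    is the normalisation performed by Gam. *)
Definition log_partition a : R := ln (\sum_i expR (a i)).

Lemma expR_log_partition a : (0 < c)%N -> expR (log_partition a) = \sum_i expR (a i).
Proof. by move=> c0; rewrite lnK// posrE; exact: sum_expR_gt0. Qed.

Lemma sum_expR_normalised a : (0 < c)%N -> \sum_i expR (a i - log_partition a) = 1.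
Proof.
move=> c0; under eq_bigr do rewrite expRB.
by rewrite -mulr_suml (expR_log_partition _ c0) mulfV// gt_eqF// sum_expR_gt0.
Qed.

Lemma spec_exp_shift U a (k : R) :
  spec_exp U (fun i => a i - k) = (expR (- k))%:C *: spec_exp U a.
Proof.
rewrite /spec_exp /spec -specmxZ; congr specmx; apply/rowP => i.
by rewrite [RHS]mxE !real_rowE expRD rmorphM mulrC.
Qed.

Lemma spec_shift U a (k : R) : U \is unitarymx ->
  spec U (fun i => a i - k) = spec U a - (k%:C)%:M.
Proof.
move=> uU; rewrite -(specmx_const _ uU) -[X in _ = _ + X]scaleN1r -specmxZ.
rewrite -specmxD; congr specmx; apply/rowP => i.
by rewrite !mxE rmorphB mulN1r.
Qed.

Lemma Gam_spec U a : (0 < c)%N -> U \is unitarymx ->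
  Gam (spec U a) = spec_exp U (fun i => a i - log_partition a).
Proof.
move=> c0 uU; rewrite /Gam (expm_spec a uU) (tr_spec _ uU) spec_exp_shift.
by rewrite expRN (expR_log_partition _ c0) fmorphV.
Qed.

Lemma Gam_density Y : (0 < c)%N -> herm Y -> density (Gam Y).
Proof.
move=> c0 /herm_specP[U uU [a ->]]; rewrite (Gam_spec a c0 uU).
by apply: (spec_exp_density uU); exact: sum_expR_normalised.
Qed.

Lemma Gam_inv_spec_exp U a : U \is unitarymx ->
  Gam_inv (spec_exp U a) = traceless (spec U a).
Proof. by move=> uU; rewrite /Gam_inv (logm_spec a uU). Qed.

(** Normalisation subtracts a scalar matrix from the logarithm, which the traceless
    part does not see. *)
Lemma GamK Y : (0 < c)%N -> herm Y -> Gam_inv (Gam Y) = proj0 Y.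
Proof.
move=> c0 /herm_specP[U uU [a ->]]; rewrite (Gam_spec a c0 uU) (Gam_inv_spec_exp _ uU).
by rewrite (spec_shift _ _ uU) tracelessB (traceless_scalar _ c0) subr0.
Qed.

Lemma Gam_shift U a (k : R) : (0 < c)%N -> U \is unitarymx ->
  Gam (spec U a - (k%:C)%:M) = Gam (spec U a).
Proof.
move=> c0 uU; transitivity (Gam (spec U (fun i => a i - k))).
  by congr Gam; exact: esym (spec_shift a k uU).
apply: etrans (Gam_spec (fun i => a i - k) c0 uU) _.
apply: etrans _ (esym (Gam_spec a c0 uU)).
congr spec_exp; apply/funext => i; rewrite -addrA -opprD; congr (_ - _).
apply: expR_inj; rewrite expRD !(expR_log_partition _ c0) mulr_sumr.
by apply: eq_bigr => j _; rewrite -expRD addrCA subrr addr0.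
Qed.

Lemma Gam_proj0 Y : (0 < c)%N -> herm Y -> Gam (proj0 Y) = Gam Y.
Proof.
move=> c0 /herm_specP[U uU [a ->]]; rewrite /proj0 (tr_spec a uU).
rewrite -[c%:R](rmorph_nat (real_complex R)) -fmorphV -rmorphM.
exact: Gam_shift.
Qed.

(** Gam ignores scalar shifts and the exponential of logm rho has trace 1 already. *)
Lemma Gam_invK rho : density rho -> Gam (Gam_inv rho) = rho.
Proof.
move=> drho; have c0 := density_gt0 drho.
have [U uU [a -> a1]] := density_spec_expP drho.
rewrite (Gam_inv_spec_exp a uU) (Gam_proj0 c0 (herm_spec _ _)) (Gam_spec a c0 uU).
by congr spec_exp; apply/funext => i; rewrite /log_partition a1 ln1 subr0.
Qed.

Lemma Gam_inv_herm rho : density rho -> herm (Gam_inv rho).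
Proof.
move=> /density_spec_expP[U uU [a -> _]]; rewrite (Gam_inv_spec_exp a uU).
exact: traceless_adj (herm_spec _ _).
Qed.

Lemma proj0E Y : proj0 Y = traceless Y.
Proof. by []. Qed.

Lemma proj0_herm Y : herm Y -> herm (proj0 Y).
Proof. exact: traceless_adj. Qed.

Lemma proj0_proj0 Y : (0 < c)%N -> proj0 (proj0 Y) = proj0 Y.
Proof. exact: traceless_idem. Qed.

(** Scalar matrices are diagonal in every basis, and the divided difference on the
    diagonal is exp itself. *)
Lemma dexp_scalar U a k : U \is unitarymx -> dexp U a k%:M = k *: spec_exp U a.
Proof.
move=> uU; rewrite /dexp (loewner_scalar _ k uU) /spec_exp /spec -[RHS]specmxZ.
congr (specmx U _); apply/rowP => i.
by rewrite [LHS]mxE [RHS]mxE real_mxE real_rowE expdd_diag.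
Qed.

Lemma tr_dexp U a X : U \is unitarymx ->
  \tr (dexp U a X) = \tr (spec_exp U a *m X).
Proof.
move=> uU; rewrite /dexp (tr_loewner _ _ uU).
rewrite (_ : \row_i _ = real_row (fun i => expR (a i))); first by [].
by apply/rowP => i; rewrite [LHS]mxE real_mxE real_rowE expdd_diag.
Qed.

Lemma dexp_herm U a X : herm X -> herm (dexp U a X).
Proof.
move=> hX; apply: loewner_adj hX; apply/matrixP => i j.
by rewrite !mxE [RHS](congr1 (real_complex R) (expddC (a i) (a j))); exact: conj_realC.
Qed.

(** The correction term is the trace of the first term, so the replicator map is the
    projection of Tinv to trace 0 along rho. *)
Lemma replicator_spec_exp U a X : U \is unitarymx ->
  replicator (spec_exp U a) X = dexp U a X - \tr (dexp U a X) *: spec_exp U a.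
Proof.
by move=> uU; rewrite /replicator (Tinv_spec a X uU) /mxinner (tr_dexp _ _ uU).
Qed.

Lemma replicatorD rho X Y : density rho ->
  replicator rho (X + Y) = replicator rho X + replicator rho Y.
Proof.
move=> /density_spec_expP[U uU [a -> _]]; rewrite !(replicator_spec_exp _ _ uU).
by rewrite /dexp loewnerD linearD scalerDl opprD addrACA.
Qed.

Lemma replicatorZ rho k X : density rho ->
  replicator rho (k *: X) = k *: replicator rho X.
Proof.
move=> /density_spec_expP[U uU [a -> _]]; rewrite !(replicator_spec_exp _ _ uU).
by rewrite /dexp loewnerZ mxtraceZ scalerBr scalerA.
Qed.

Lemma replicator_scalar rho k : density rho -> replicator rho k%:M = 0.
Proof.
move=> /density_spec_expP[U uU [a -> a1]]; rewrite (replicator_spec_exp _ _ uU).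
rewrite (dexp_scalar a k uU) mxtraceZ (tr_spec_exp a uU) a1.
by rewrite [k * _]mulr1 subrr.
Qed.

(** The replicator map kills scalar matrices, since Tinv rho 1 = rho. *)
Lemma replicator_proj0 rho X : density rho ->
  replicator rho (proj0 X) = replicator rho X.
Proof.
move=> drho; rewrite /proj0 -scaleN1r -scalemx1 scalerA scalemx1.
by rewrite (replicatorD _ _ drho) (replicator_scalar _ drho) addr0.
Qed.

Lemma replicator_herm0 rho X : density rho -> herm X ->
  herm0 (replicator rho X).
Proof.
move=> /density_spec_expP[U uU [a -> a1]] hX; rewrite (replicator_spec_exp _ _ uU).
split; first exact: sub_trace_scale_adj (dexp_herm _ _ hX) (herm_spec _ _).
by apply: tr_sub_trace_scale; rewrite (tr_spec_exp a uU) a1.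
Qed.

Lemma dlogB U a X Y : dlog U a (X - Y) = dlog U a X - dlog U a Y.
Proof. exact: loewnerB. Qed.

Lemma dlogZ U a k X : dlog U a (k *: X) = k *: dlog U a X.
Proof. exact: loewnerZ. Qed.

Lemma dlog_spec_exp U a : U \is unitarymx -> dlog U a (spec_exp U a) = 1%:M.
Proof.
move=> uU; rewrite -[X in dlog _ _ X]scale1r -(dexp_scalar _ _ uU).
exact: dlogK.
Qed.

(** dlog inverts dexp and sends rho to the identity matrix, so the correction term
    of the replicator map becomes a scalar matrix. *)
Lemma dlog_replicator U a X : U \is unitarymx -> exists k,
  dlog U a (replicator (spec_exp U a) X) = X - k%:M.
Proof.
move=> uU; exists (\tr (dexp U a X)); rewrite (replicator_spec_exp _ _ uU).
by rewrite dlogB (dlogK a X uU) dlogZ (dlog_spec_exp a uU) scalemx1.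
Qed.

Lemma proj0_dlog_replicator U a X : (0 < c)%N -> U \is unitarymx ->
  proj0 (dlog U a (replicator (spec_exp U a) X)) = proj0 X.
Proof.
move=> c0 uU; have [k ->] := dlog_replicator a X uU.
by rewrite !proj0E tracelessB (traceless_scalar _ c0) subr0.
Qed.

(** The logarithm of Exp_e moves by the traceless part of Tmap, and that of
    Tmap (replicator X) is that of X. *)
Lemma Exp_e_replicator rho X : density rho -> herm X ->
  Exp_e rho (replicator rho X) = Gam (Gam_inv rho + proj0 X).
Proof.
move=> drho hX; rewrite /Exp_e; congr (Gam (_ + _)).
have [hT _] := replicator_herm0 drho hX.
have c0 := density_gt0 drho; move: hT.
have [U uU [a -> a1]] := density_spec_expP drho => hT.
by rewrite (Tmap_spec a uU hT) proj0_dlog_replicator.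
Qed.

(** Equal images have tangent vectors whose images under Tmap differ by a scalar k,
    so the vectors differ by k rho; having the same trace they are equal. *)
Lemma Exp_e_inj rho : density rho -> {in herm0 &, injective (Exp_e rho)}.
Proof.
move=> drho X Y /[!inE] -[hX trX] [hY trY].
have c0 := density_gt0 drho; have hG := Gam_inv_herm drho; move: hG.
have [U uU [a -> a1]] := density_spec_expP drho => hG.
rewrite /Exp_e (Tmap_spec a uU hX) (Tmap_spec a uU hY).
move=> /(congr1 (@Gam_inv R c)).
have hdlog Z : herm Z -> herm (dlog U a Z).
  move=> hZ; apply: loewner_adj hZ; apply/matrixP => i j; rewrite !mxE.
  by rewrite [RHS](congr1 (fun x => (x^-1)%:C) (expddC (a i) (a j))); exact: conj_realC.
have hs Z : herm Z -> herm (Gam_inv (spec_exp U a) + proj0 (dlog U a Z)).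
  move=> /hdlog/proj0_herm h.
  by rewrite /herm /= adjD hG h.
have GX := GamK c0 (hs X hX); have GY := GamK c0 (hs Y hY).
move=> GXY; have := etrans (esym GX) (etrans GXY GY).
move=> /(traceless_addI c0).
rewrite -dlogB => /(congr1 (dexp U a)); rewrite (dexpK a (X - Y) uU).
rewrite (dexp_scalar _ _ uU) => XY.
apply/eqP; rewrite -subr_eq0; apply/eqP; apply: (tr_scale1_eq0 _ _ XY).
  by rewrite linearB /= trX trY subrr.
by rewrite (tr_spec_exp a uU) a1.
Qed.

Lemma Exp_e_invE rho X : density rho -> herm X ->
  Exp_e_inv rho (Gam (Gam_inv rho + proj0 X)) = replicator rho X.
Proof.
move=> drho hX; rewrite -(Exp_e_replicator drho hX).
apply: pinvKV; first exact: Exp_e_inj.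
by rewrite inE; exact: replicator_herm0.
Qed.

End Density.

(** * The replicator equation in the coordinate Gam_inv *)

Section Curves.
Variables (R : realType) (c : nat).
Local Notation C := R[i].
Local Notation M := 'M[R[i]]_c.
Implicit Types (J : set R) (F : R -> M) (U V X Y Z A B P rho : M) (a b : 'I_c -> R).

Lemma norm1Z_le (z : C) X : norm1 (z *: X) <= cabs1 z * norm1 X.
Proof.
rewrite /norm1 mulr_sumr; apply: ler_sum => i _.
by rewrite mulr_sumr; apply: ler_sum => j _; rewrite mxE; exact: cabs1M.
Qed.

Lemma cabs1_tr X : cabs1 (\tr X) <= norm1 X.
Proof.
apply: le_trans (cabs1_sum _ _) _; apply: ler_sum => i _.
by rewrite (bigD1 i)//= lerDl; apply: sumr_ge0 => j _; exact: cabs1_ge0.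
Qed.

Lemma linear_bounded_proj0 : linear_bounded (@proj0 R c).
Proof.
split; [exact: tracelessB | by move=> r X; exact: tracelessZ |].
pose k := cabs1 (c%:R^-1 : C) * norm1 (1%:M : M).
have k0 : 0 <= k by rewrite mulr_ge0 ?cabs1_ge0 ?norm1_ge0.
exists (1 + k); first by rewrite addr_ge0.
move=> X; apply: le_trans (norm1B _ _) _; rewrite mulrDl mul1r lerD2l.
rewrite -scalemx1; apply: le_trans (norm1Z_le _ _) _.
rewrite [leRHS](_ : _ = norm1 X * cabs1 (c%:R^-1 : C) * norm1 (1%:M : M)).
  2: by rewrite /k mulrC mulrA.
apply: ler_wpM2r; first exact: norm1_ge0.
by apply: le_trans (cabs1M _ _) _; apply: ler_wpM2r (cabs1_tr _); exact: cabs1_ge0.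
Qed.

(** The map that takes expm to Gam. *)
Definition trace_normalise P : M := (\tr P)^-1 *: P.

(** The derivative of trace_normalise at P. *)
Definition dtrace_normalise P X : M :=
  (\tr P)^-1 *: (X - \tr X *: ((\tr P)^-1 *: P)).

Definition real_trace P := exists r : R, \tr P = r%:C.

Lemma norm1_trace_correction P (k : C) :
  exists2 K : R, 0 <= K & forall X, norm1 (X - \tr X *: (k *: P)) <= K * norm1 X.
Proof.
exists (1 + norm1 (k *: P)); first by rewrite addr_ge0 ?norm1_ge0.
move=> X; apply: le_trans (norm1B _ _) _; rewrite mulrDl mul1r lerD2l mulrC.
apply: le_trans (norm1Z_le _ _) _.
by apply: ler_wpM2r (cabs1_tr _); exact: norm1_ge0.
Qed.

Lemma linear_bounded_dtrace_normalise P : linear_bounded (dtrace_normalise P).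
Proof.
have [K K0 HK] := norm1_trace_correction P (\tr P)^-1.
split.
- by move=> X Y; rewrite /dtrace_normalise trace_correctionB scalerBr.
- move=> r X; rewrite /dtrace_normalise trace_correctionZ !scalerA.
  by congr (_ *: _); rewrite mulrC.
- exists (cabs1 (\tr P)^-1 * K); first by rewrite mulr_ge0 ?cabs1_ge0.
  move=> X; apply: le_trans (norm1Z_le _ _) _; rewrite -mulrA.
  by apply: ler_wpM2l (HK X); exact: cabs1_ge0.
Qed.

(** Matrices near P have trace at least half the trace of P, which bounds the
    factor 1 / (tr X tr P) of the quadratic error. *)
Lemma trace_normalise_second_order P (y : R) : 0 < y -> \tr P = y%:C ->
  second_order_at real_trace trace_normalise (dtrace_normalise P) P.
Proof.
move=> y0 trP; have [K K0 HK] := norm1_trace_correction P (\tr P)^-1.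
exists (2 / (y * y) * K); first by rewrite mulr_ge0// divr_ge0// mulr_ge0// ltW.
exists (y / 2); first by rewrite divr_gt0.
move=> X [z trX] near.
have zy : `|z - y| <= norm1 (X - P).
  have e : (z - y)%:C = \tr (X - P) by rewrite linearB /= trX trP rmorphB.
  by rewrite -cabs1_real e; exact: cabs1_tr.
have z2 : y / 2 <= z.
  have := le_trans zy near; rewrite ler_norml => /andP[h _]; lra.
have z0 : 0 < z by apply: lt_le_trans z2; rewrite divr_gt0.
have nX : \tr X != 0 by rewrite trX fmorph_eq0 gt_eqF.
have nP : \tr P != 0 by rewrite trP fmorph_eq0 gt_eqF.
rewrite (normalise_remainder nX nP).
rewrite [X in X *: _](_ : _ = (- (z - y) / (z * y))%:C).
  2: by rewrite trX trP -rmorphB -rmorphN -rmorphM -fmorphV -rmorphM.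
rewrite norm1_realZ.
rewrite [leRHS](_ : _ = (2 / (y * y) * norm1 (X - P)) * (K * norm1 (X - P)));
  last by ring.
apply: ler_pM (normr_ge0 _) (norm1_ge0 _) _ (HK _).
rewrite normrM normrN normfV mulrC ger0_norm ?mulr_ge0 ?(ltW z0) ?(ltW y0)//.
apply: ler_pM => //; first by rewrite invr_ge0 mulr_ge0 ?(ltW z0) ?(ltW y0).
rewrite -[2 / _]invrK lef_pV2 ?posrE ?invr_gt0 ?divr_gt0 ?mulr_gt0//.
by rewrite invfM invrK mulrA ler_wpM2r ?(ltW y0)// mulrC.
Qed.

Lemma dexp_shift U a (k : R) X :
  dexp U (fun i => a i - k) X = (expR (- k))%:C *: dexp U a X.
Proof.
rewrite /dexp -loewner_scale; congr loewner; apply/matrixP => i j.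
by rewrite [RHS]mxE !real_mxE expdd_shift rmorphM.
Qed.

Lemma dtrace_normalise_dexp U a X : (0 < c)%N -> U \is unitarymx ->
  dtrace_normalise (spec_exp U a) (dexp U a X) = replicator (Gam (spec U a)) X.
Proof.
move=> c0 uU; rewrite (Gam_spec a c0 uU) (replicator_spec_exp _ _ uU).
rewrite dexp_shift spec_exp_shift mxtraceZ /dtrace_normalise (tr_spec_exp a uU).
rewrite -(expR_log_partition a c0) -fmorphV -expRN scalerBr !scalerA.
by [].
Qed.

(** The chain rule through expm and the normalisation of the trace. *)
Lemma frechet_Gam J F t X : (0 < c)%N -> (forall s, J s -> herm (F s)) -> J t ->
  frechet J F t X ->
  frechet J (fun s => Gam (F s)) t (replicator (Gam (F t)) X).
Proof.
move=> c0 hF Jt FX; have [U uU [a Fa]] := herm_specP (hF t Jt).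
have expF : frechet J (@expm R c \o F) t (dexp U a X).
  apply: (frechet_comp (P := herm)) FX.
  - exact: linear_bounded_dexp.
  - by rewrite Fa; exact: expm_second_order.
  - by have := near_within_mem J t; apply: filterS => s; exact: hF.
rewrite Fa -(dtrace_normalise_dexp a X c0 uU).
have trE s : J s -> real_trace (expm (F s)).
  move=> /hF/herm_specP[V uV [b ->]]; exists (\sum_i expR (b i)).
  by rewrite (expm_spec b uV) (tr_spec _ uV).
apply: (frechet_comp (P := real_trace) (f := trace_normalise)) expF.
- exact: linear_bounded_dtrace_normalise.
- rewrite /= Fa (expm_spec a uU) -/(spec_exp U a).
  by apply: (trace_normalise_second_order (sum_expR_gt0 a c0)); exact: tr_spec_exp.
- by have := near_within_mem J t; apply: filterS => s; exact: trE.
Qed.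

(** The chain rule through logm and proj0: dlog turns the replicator map into X up
    to a scalar matrix, which proj0 removes. *)
Lemma frechet_Gam_inv J F t X : (forall s, J s -> density (F s)) -> J t ->
  frechet J F t (replicator (F t) X) ->
  frechet J (fun s => Gam_inv (F s)) t (proj0 X).
Proof.
move=> dF Jt FX; have c0 := density_gt0 (dF t Jt).
have [U uU [a Fa _]] := density_spec_expP (dF t Jt).
rewrite -(proj0_dlog_replicator a X c0 uU) -Fa.
apply: (frechet_linear (F := @logm R c \o F) linear_bounded_proj0).
apply: (frechet_comp (P := herm)) FX.
- exact: linear_bounded_dlog.
- by rewrite Fa; exact: logm_second_order.
- by have := near_within_mem J t; apply: filterS => s /dF[].
Qed.

Lemma herm0_Gam_inv rho : density rho -> herm0 (Gam_inv rho).
Proof.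
move=> drho; split; first exact: Gam_inv_herm.
by apply: tr_traceless; exact: density_gt0 drho.
Qed.

Lemma herm0_proj0 X : (0 < c)%N -> herm X -> herm0 (proj0 X).
Proof. by move=> c0 hX; split; [exact: proj0_herm | exact: tr_traceless]. Qed.

Lemma herm0B X Y : herm0 X -> herm0 Y -> herm0 (X - Y).
Proof.
move=> [hX tX] [hY tY]; split; first by rewrite /herm /= adjB hX hY.
by rewrite linearB /= tX tY subrr.
Qed.

Lemma herm0_realZ (r : R) X : herm0 X -> herm0 (r%:C *: X).
Proof.
move=> [hX tX]; split; last by rewrite mxtraceZ tX mulr0.
by rewrite /herm /= adjZ hX; congr (_ *: _); exact: conj_realC.
Qed.

Lemma herm0D X Y : herm0 X -> herm0 Y -> herm0 (X + Y).
Proof.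
move=> [hX tX] [hY tY]; split; first by rewrite /herm /= adjD hX hY.
by rewrite linearD /= tX tY addr0.
Qed.

Lemma herm0_sum (I : finType) (p : pred I) (F : I -> M) :
  (forall k, herm0 (F k)) -> herm0 (\sum_(k | p k) F k).
Proof.
move=> hF; apply: (big_ind (fun X => herm0 X)) => [|X Y|k _].
- by split; rewrite ?linear0// /herm /= trmx0 map_mx0.
- exact: herm0D.
- exact: hF.
Qed.

Lemma proj0_id X : herm0 X -> proj0 X = X.
Proof. by move=> [_ tX]; exact: traceless_id. Qed.

Lemma proj0_sum (I : finType) (p : pred I) (w : I -> R) (F : I -> M) :
  proj0 (\sum_(k | p k) (w k)%:C *: F k) = \sum_(k | p k) (w k)%:C *: proj0 (F k).
Proof.
rewrite proj0E (big_morph (@traceless _ c) (@tracelessD _ c) (_ : _ = 0)).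
  by apply: eq_bigr => k _; exact: tracelessZ.
by rewrite -[0 in LHS](scale0r (0 : M)) tracelessZ scale0r.
Qed.

Lemma replicator_sum rho (I : finType) (p : pred I) (w : I -> R) (F : I -> M) :
  density rho -> replicator rho (\sum_(k | p k) (w k)%:C *: F k) =
  \sum_(k | p k) (w k)%:C *: replicator rho (F k).
Proof.
move=> drho; rewrite (big_morph (replicator rho)
    (fun X Y => replicatorD X Y drho) (_ : _ = 0)).
  by apply: eq_bigr => k _; exact: replicatorZ.
by rewrite -[0 in LHS](scale0r (0 : M)) (replicatorZ _ _ drho) scale0r.
Qed.

Lemma likelihoodE rho D : density rho -> herm D ->
  likelihood rho D = Gam (Gam_inv rho - proj0 D).
Proof.
move=> drho hD; have c0 := density_gt0 drho.
have [hN tN] : herm0 (- proj0 D).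
  by rewrite -sub0r; apply: herm0B; [| exact: herm0_proj0];
    split; rewrite ?linear0// /herm /= trmx0 map_mx0.
rewrite /likelihood /exp_at (Exp_e_replicator drho hN).
by rewrite (proj0_id (conj hN tN)).
Qed.

(** In logarithms Exp_e is a translation, so its inverse is a difference of
    logarithms, carried to the tangent space by the replicator map. *)
Lemma Exp_e_inv_Gam rho X : density rho -> herm0 X ->
  Exp_e_inv rho (Gam X) = replicator rho (X - Gam_inv rho).
Proof.
move=> drho hX; have h := herm0B hX (herm0_Gam_inv drho).
have [hB _] := h; rewrite -(Exp_e_invE drho hB) (proj0_id h).
by rewrite addrCA subrr addr0.
Qed.

End Curves.

(** * The similarity map and the equivalence of the two systems *)

Section AssignmentFlow.
Variables (R : realType) (c : nat) (V : finType) (E : rel V) (w : V -> V -> R).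
Local Notation C := R[i].
Local Notation M := 'M[R[i]]_c.
Local Notation field := (V -> M).
Implicit Types (rho mu D : field) (J : set R).

(** The traceless logarithm of the similarity, affine in the logarithms of rho. *)
Definition log_similarity D rho : field := fun i =>
  \sum_(k in nbh E i) (w i k)%:C *: (Gam_inv (rho k) - proj0 (D k)).

Lemma herm0_log_similarity D rho i : (forall k, herm (D k)) -> QQ rho ->
  herm0 (log_similarity D rho i).
Proof.
move=> hD hrho; apply: herm0_sum => k; apply: herm0_realZ.
apply: herm0B; first exact: herm0_Gam_inv.
by apply: herm0_proj0 (hD k); exact: density_gt0 (hrho k).
Qed.

(** The tangent vectors that are averaged are images of differences of logarithms
    under the one linear map replicator (rho i); the weights sum to 1, so the
    logarithm of the base point rho i cancels. *)
Lemma similarityE D rho i : \sum_(k in nbh E i) w i k = 1 ->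
  (forall k, herm (D k)) -> QQ rho ->
  similarity E w D rho i = Gam (log_similarity D rho i).
Proof.
move=> w1 hD hrho; have hi := hrho i.
pose A k := Gam_inv (rho k) - proj0 (D k).
have hA k : herm0 (A k).
  apply: herm0B; first exact: herm0_Gam_inv.
  by apply: herm0_proj0 (hD k); exact: density_gt0 (hrho k).
have hS : herm0 (\sum_(k in nbh E i) (w i k)%:C *: (A k - Gam_inv (rho i))).
  by apply: herm0_sum => k; apply/herm0_realZ/herm0B/herm0_Gam_inv.
have [hS1 _] := hS.
rewrite /similarity.
have -> : \sum_(k in nbh E i) (w i k)%:C *:
    Exp_e_inv (rho i) (likelihood (rho k) (D k)) =
    replicator (rho i) (\sum_(k in nbh E i) (w i k)%:C *: (A k - Gam_inv (rho i))).
  rewrite (replicator_sum _ _ _ hi); apply: eq_bigr => k _; congr (_ *: _).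
  by rewrite (likelihoodE (hrho k) (hD k)); exact: (Exp_e_inv_Gam hi (hA k)).
rewrite (Exp_e_replicator hi hS1) (proj0_id hS); congr Gam.
under eq_bigr do rewrite scalerBr.
rewrite sumrB -scaler_suml -rmorph_sum w1 scale1r addrCA subrr addr0.
by [].
Qed.

Lemma frechet_log_similarity D J (rho : R -> field) X t i :
  (forall s, J s -> QQ (rho s)) -> J t ->
  (forall k, frechet J (fun s => rho s k) t (replicator (rho t k) (X k))) ->
  frechet J (fun s => log_similarity D (rho s) i) t (proj0 (Omega E w X i)).
Proof.
move=> hrho Jt drho; rewrite /Omega proj0_sum.
apply: frechet_sum => k; apply: frechetZ; rewrite -[proj0 (X k)]addr0.
apply: frechetD; last exact: frechet_cst.
by apply: frechet_Gam_inv (drho k) => // s Js; exact: hrho.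
Qed.

End AssignmentFlow.

Theorem proposition4p16 (R : realType) (c : nat) (V : finType) (E : rel V)
  (w : V -> V -> R) (D : V -> 'M[R[i]%C]_c)
  (w_ge0 : forall i k : V, 0 <= w i k)
  (w_supp : forall i k : V, k \notin nbh E i -> w i k = 0)
  (w_sum1 : forall i : V, \sum_(k in nbh E i) w i k = 1)
  (D_herm : forall i : V, herm (D i))
  (J : set R) (J_itv : is_interval J) (J0 : J 0)
  (rho : R -> V -> 'M[R[i]%C]_c) :
  solves_qsaf E w D J rho <->
  exists mu : R -> V -> 'M[R[i]%C]_c, solves_system E w D J rho mu.
Proof.
have simE (r : V -> 'M[R[i]%C]_c) i : QQ r ->
    similarity E w D r i = Gam (log_similarity E w D r i).
  by move=> hr; exact: similarityE.
have hlog (r : V -> 'M[R[i]%C]_c) i : QQ r -> herm0 (log_similarity E w D r i).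
  by move=> hr; exact: herm0_log_similarity.
have dlog_sim (mu : R -> V -> 'M[R[i]%C]_c) t i :
    solves_in J rho (fun t => replicatorQ (rho t) (mu t)) -> J t ->
    frechet J (fun s => log_similarity E w D (rho s) i) t
      (proj0 (Omega E w (mu t) i)).
  move=> sol Jt; apply: frechet_log_similarity => [s Js|//|k].
    by have [] := sol s Js.
  by have [_ drho] := sol t Jt; apply/mx_has_derive_in_frechet/drho.
split=> [[sol rho0]|[mu [sol rho0 solmu mu0]]].
- pose mu t := similarity E w D (rho t).
  have hrho t : J t -> QQ (rho t) by move=> /sol[].
  exists mu; split; [exact: sol | exact: rho0 | | by rewrite /mu rho0].
  move=> t Jt; have hQ : QQ (mu t).
    move=> i; rewrite /mu (simE _ _ (hrho t Jt)).
    have [h _] := hlog (rho t) i (hrho t Jt).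
    by apply: Gam_density h; exact: density_gt0 (hrho t Jt i).
  split=> [|i]; [exact: hQ | apply/mx_has_derive_in_frechet].
  have muE s : J s -> mu s i = Gam (log_similarity E w D (rho s) i).
    by move=> Js; exact: simE (hrho s Js).
  have h s : J s -> herm (log_similarity E w D (rho s) i).
    by move=> Js; have [] := hlog (rho s) i (hrho s Js).
  have := frechet_Gam (density_gt0 (hrho t Jt i)) h Jt (dlog_sim mu t i sol Jt).
  rewrite -(muE t Jt) (replicator_proj0 _ (hQ i)); apply: frechet_eq Jt.
  by move=> s Js; exact: esym (muE s Js).
- have hrho t : J t -> QQ (rho t) by move=> /sol[].
  have hmu t : J t -> QQ (mu t) by move=> /solmu[].
  have mu_sim t i : J t -> mu t i = similarity E w D (rho t) i.
    move=> Jt.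
    (* Both terms have derivative proj0 (Omega (mu s) i), so their difference keeps
       its initial value 0. *)
    pose F s := Gam_inv (mu s i) - log_similarity E w D (rho s) i.
    have dF s : J s -> frechet J F s 0.
      move=> Js; rewrite -[0](subrr (proj0 (Omega E w (mu s) i))) -scaleN1r.
      have -> : F = fun s => Gam_inv (mu s i) +
          (-1)%:C *: log_similarity E w D (rho s) i.
        by apply/funext => u; rewrite rmorphN1 scaleN1r.
      rewrite -[X in X *: _](rmorphN1 (real_complex R)).
      apply: frechetD; last by apply: frechetZ; exact: dlog_sim.
      have [_ dmu] := solmu s Js.
      apply: frechet_Gam_inv => // [u Ju|]; first exact: hmu.
      by apply/mx_has_derive_in_frechet; exact: dmu.
    have F0 : F 0 = 0.
      rewrite /F mu0 -rho0 (simE _ _ (hrho 0 J0)).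
      have h := hlog (rho 0) i (hrho 0 J0); have [h1 _] := h.
      rewrite (GamK (density_gt0 (hrho 0 J0 i)) h1) (proj0_id h).
      exact: subrr.
    have : F t = 0 by rewrite -F0; exact: (const_of_frechet0 J_itv dF Jt J0).
    move=> /subr0_eq e; rewrite (simE _ _ (hrho t Jt)) -e.
    by rewrite (Gam_invK (hmu t Jt i)).
  split; last exact: rho0.
  move=> t Jt; have [hQ drho] := sol t Jt; split=> [|i]; first exact: hQ.
  have -> : similarity E w D (rho t) = mu t.
    by apply/funext => k; exact/esym/mu_sim.
  exact: drho.
Qed.
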